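(* Let $n\geqslant4$ and let $\overline M\times_F\widetilde N$ be an $n$-dimensional generalized Robertson-Walker spacetime (so $\dim\overline M=1$, $\bar g_{11}=\varepsilon=-1$, and $(\widetilde N,\tilde g)$ is an $(n-1)$-dimensional Riemannian manifold) whose fiber $(\widetilde N,\tilde g)$ is not an Einstein manifold. Suppose that $$R\cdot C-C\cdot R=L\,Q(S,R)$$ holds on the set $U\subset\overline M\times_F\widetilde N$ of all points at which $Q(S,R)\neq0$, where $L$ is some function on $U$. Then there are $a,b\in\mathbb{R}$ such that on the set $\mathcal{U}=U\cap U_S\cap U_C$ we have $$L=\frac{1}{n-2},\qquad F(x^1)=(ax^1+b)^2,$$ and the fiber satisfies (on $\mathcal{U}$), with $\varepsilon=-1$, $$\widetilde S_{\mu}{}^{\epsilon}\widetilde R_{\epsilon\beta\gamma\delta}=\frac{\tilde\kappa}{n-1}\,\widetilde R_{\mu\beta\gamma\delta}+\varepsilon a^2\bigl(\tilde g_{\beta\gamma}\widetilde S_{\mu\delta}-\tilde g_{\beta\delta}\widetilde S_{\mu\gamma}\bigr)-\frac{\varepsilon\tilde\kappa a^2}{n-1}\,\widetilde G_{\mu\beta\gamma\delta}.$$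
   Context: All manifolds are connected, paracompact and $C^\infty$. For a semi-Riemannian manifold $(M,g)$ of dimension $n$ with Levi-Civita connection $\nabla$ and a symmetric $(0,2)$-tensor $A$: $(X\wedge_AY)Z=A(Y,Z)X-A(X,Z)Y$; $\mathcal R(X,Y)Z=\nabla_X\nabla_YZ-\nabla_Y\nabla_XZ-\nabla_{[X,Y]}Z$; $S(X,Y)=\mathrm{tr}\{Z\mapsto\mathcal R(Z,X)Y\}$ is the Ricci tensor; the Ricci operator $\mathcal S$ is given by $g(\mathcal SX,Y)=S(X,Y)$; $\kappa=\mathrm{tr}\,\mathcal S$; $\mathcal C(X,Y)=\mathcal R(X,Y)-\frac{1}{n-2}\bigl(X\wedge_g\mathcal SY+\mathcal SX\wedge_gY-\frac{\kappa}{n-1}X\wedge_gY\bigr)$. The $(0,4)$-tensors are $G(X_1,X_2,X_3,X_4)=g((X_1\wedge_gX_2)X_3,X_4)$, $R(X_1,X_2,X_3,X_4)=g(\mathcal R(X_1,X_2)X_3,X_4)$, $C(X_1,X_2,X_3,X_4)=g(\mathcal C(X_1,X_2)X_3,X_4)$ (Weyl tensor). For $\mathcal B\in\{\mathcal R,\mathcal C\}$ with associated $(0,4)$-tensor $B\in\{R,C\}$ and a $(0,k)$-tensor $T$: $(B\cdot T)(X_1,\dots,X_k;X,Y)=-\sum_{i=1}^kT(X_1,\dots,\mathcal B(X,Y)X_i,\dots,X_k)$, and $Q(A,T)(X_1,\dots,X_k;X,Y)=-\sum_{i=1}^kT(X_1,\dots,(X\wedge_AY)X_i,\dots,X_k)$.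 $(M,g)$ is Einstein if $S=\frac{\kappa}{n}g$ at every point. $U_S=\{x: S\neq\frac{\kappa}{n}g\text{ at }x\}$, $U_C=\{x: C\neq0\text{ at }x\}$. The warped product $\overline M\times_F\widetilde N$ (with $F:\overline M\to\mathbb{R}^+$ smooth) is $\overline M\times\widetilde N$ with metric $g=\pi_1^*\bar g+(F\circ\pi_1)\pi_2^*\tilde g$, $\pi_1,\pi_2$ being the projections. It is called a generalized Robertson-Walker spacetime if $\dim\overline M=1$, $\bar g_{11}=-1$ and $(\widetilde N,\tilde g)$ is an $(n-1)$-dimensional Riemannian manifold, $n\geqslant4$. $R,S,C,\kappa$ refer to $g$; tensors with a tilde ($\widetilde R,\widetilde S,\widetilde G,\tilde\kappa$) are those of $(\widetilde N,\tilde g)$, and relations among them on a set in the product are understood via $\pi_2$. Considerations are local, in product charts; $x^1$ is the coordinate on $\overline M$ with $\bar g_{11}=-1$. Greek indices refer to the fiber, $\widetilde R_{\mu\beta\gamma\delta}=\widetilde R(\partial_\mu,\partial_\beta,\partial_\gamma,\partial_\delta)$, and $\widetilde S_\mu{}^\epsilon=\tilde g^{\epsilon\nu}\widetilde S_{\mu\nu}$. *)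

(* Defs.v *)
From HB Require Import structures.
From mathcomp Require Import all_boot all_order all_algebra.
From mathcomp Require Import all_classical all_reals all_analysis.

Set Implicit Arguments.
Unset Strict Implicit.
Unset Printing Implicit Defensive.
Import Order.TTheory GRing.Theory Num.Theory.
Import numFieldNormedType.Exports.

Local Open Scope classical_set_scope.
Local Open Scope ring_scope.

(** * Smooth functions on open subsets of R^d *)

Definition partial (R : realType) (d : nat) (i : 'I_d) (f : 'rV[R]_d -> R) :
  'rV[R]_d -> R := fun y => 'D_(delta_mx 0 i) f y.

Definition iter_partial (R : realType) (d : nat) (s : seq 'I_d)
  (f : 'rV[R]_d -> R) : 'rV[R]_d -> R := foldr (fun i h => partial i h) f s.

(* C^oo on O (used for open O only): partial derivatives of all orders exist
   and are continuous. *)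
Definition smooth_on (R : realType) (d : nat) (O : set 'rV[R]_d)
  (f : 'rV[R]_d -> R) : Prop :=
  forall (s : seq 'I_d) (y : 'rV[R]_d), O y ->
    {for y, continuous (iter_partial s f)} /\
    forall i : 'I_d, derivable (iter_partial s f) y (delta_mx 0 i).

(** * Smooth manifolds *)

Definition paracompact (T : topologicalType) : Prop :=
  forall C : set (set T), C `<=` open -> \bigcup_(V in C) V = setT ->
  exists D : set (set T),
    [/\ D `<=` open,
        \bigcup_(V in D) V = setT,
        (forall V, D V -> exists2 W, C W & V `<=` W) &
        (forall x : T, exists2 N, nbhs x N &
           finite_set [set V | D V /\ (V `&` N !=set0)])].

(* A chart is a pair of total functions; the values of [chart_map] outside
   [chart_dom] and of [chart_inv] outside the image are irrelevant. *)
Record chart (R : realType) (d : nat) (M : Type) := Chart {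
  chart_dom : set M;
  chart_map :> M -> 'rV[R]_d;
  chart_inv : 'rV[R]_d -> M
}.

Definition chart_img (R : realType) (d : nat) (M : Type) (c : chart R d M) :
  set 'rV[R]_d := c @` chart_dom c.

Definition is_chart (R : realType) (d : nat) (M : topologicalType)
  (c : chart R d M) : Prop :=
  [/\ open (chart_dom c),
      open (chart_img c),
      (forall x, chart_dom c x -> chart_inv c (c x) = x),
      (forall x, chart_dom c x -> {for x, continuous c}) &
      (forall y, chart_img c y -> {for y, continuous (chart_inv c)})].

Definition transition (R : realType) (d : nat) (M : Type)
  (c c' : chart R d M) : 'rV[R]_d -> 'rV[R]_d := fun y => c' (chart_inv c y).

Definition smooth_transition (R : realType) (d : nat) (M : Type)
  (c c' : chart R d M) : Prop :=
  forall k : 'I_d, smooth_on (c @` (chart_dom c `&` chart_dom c'))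
    (fun y => transition c c' y 0 k).

(* Connected, Hausdorff, paracompact, with a maximal smooth atlas. *)
Record smoothManifold (R : realType) (d : nat) := SmoothManifold {
  manifold_space :> topologicalType;
  atlas : set (chart R d manifold_space);
  _ : hausdorff_space manifold_space;
  _ : connected [set: manifold_space];
  _ : paracompact manifold_space;
  _ : forall c, atlas c -> is_chart c;
  _ : forall x, exists2 c, atlas c & chart_dom c x;
  _ : forall c c', atlas c -> atlas c' -> smooth_transition c c';
  _ : forall c, is_chart c ->
        (forall c', atlas c' ->
           smooth_transition c c' /\ smooth_transition c' c) -> atlas c
}.

Definition smooth_function (R : realType) (d : nat) (M : smoothManifold R d)
  (f : M -> R) : Prop :=
  forall c, atlas c -> smooth_on (chart_img c) (f \o chart_inv c).

(* [metric_mx g c y] is the matrix (g_ij) in the chart c, at the coordinates y. *)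
Record semiRiemMetric (R : realType) (d : nat) (M : smoothManifold R d) :=
  SemiRiemMetric {
  metric_mx :> chart R d M -> 'rV[R]_d -> 'M[R]_d;
  _ : forall c, atlas c -> forall i j,
        smooth_on (chart_img c) (fun y => metric_mx c y i j);
  _ : forall c, atlas c -> forall y, chart_img c y ->
        (metric_mx c y)^T = metric_mx c y;
  _ : forall c, atlas c -> forall y, chart_img c y ->
        metric_mx c y \in unitmx;
  _ : forall c c' x, atlas c -> atlas c' -> chart_dom c x -> chart_dom c' x ->
        let J := jacobian (transition c c') (c x) in
        metric_mx c (c x) = J *m metric_mx c' (c' x) *m J^T
}.

Definition riemannian (R : realType) (d : nat) (M : smoothManifold R d)
  (g : semiRiemMetric M) : Prop :=
  forall c, atlas c -> forall y, chart_img c y ->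
  forall v : 'rV[R]_d, v != 0 -> 0 < (v *m g c y *m v^T) 0 0.

(** * Curvature in a chart

  Below [g : 'rV[R]_d -> 'M[R]_d] is a metric in coordinates, y a point, and
  X, Y, Z, X1, ... are tangent vectors at y in the coordinate basis. *)

Definition tensor2 (R : realType) (d : nat) := 'rV[R]_d -> 'rV[R]_d -> R.

Definition tensor4 (R : realType) (d : nat) :=
  'rV[R]_d -> 'rV[R]_d -> 'rV[R]_d -> 'rV[R]_d -> R.

Definition metric (R : realType) (d : nat) (g : 'rV[R]_d -> 'M[R]_d)
  (y : 'rV[R]_d) : tensor2 R d := fun X Y => (X *m g y *m Y^T) 0 0.

Definition christoffel (R : realType) (d : nat) (g : 'rV[R]_d -> 'M[R]_d)
  (k i j : 'I_d) (y : 'rV[R]_d) : R :=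
  2^-1 * \sum_(l < d) invmx (g y) k l *
    (partial i (fun z => g z j l) y + partial j (fun z => g z i l) y
     - partial l (fun z => g z i j) y).

(* Levi-Civita connection, on vector fields given by their components. *)
Definition nabla (R : realType) (d : nat) (g : 'rV[R]_d -> 'M[R]_d)
  (X Y : 'rV[R]_d -> 'rV[R]_d) : 'rV[R]_d -> 'rV[R]_d := fun y =>
  \row_k \sum_(i < d) X y 0 i *
    (partial i (fun z => Y z 0 k) y
     + \sum_(j < d) christoffel g k i j y * Y y 0 j).

Definition lie_bracket (R : realType) (d : nat)
  (X Y : 'rV[R]_d -> 'rV[R]_d) : 'rV[R]_d -> 'rV[R]_d := fun y =>
  \row_k \sum_(i < d) (X y 0 i * partial i (fun z => Y z 0 k) y
                       - Y y 0 i * partial i (fun z => X z 0 k) y).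

Definition curvature_field (R : realType) (d : nat) (g : 'rV[R]_d -> 'M[R]_d)
  (X Y Z : 'rV[R]_d -> 'rV[R]_d) : 'rV[R]_d -> 'rV[R]_d := fun y =>
  nabla g X (nabla g Y Z) y - nabla g Y (nabla g X Z) y
  - nabla g (lie_bracket X Y) Z y.

(* By tensoriality, the vectors may be extended to fields with constant
   components. *)
Definition riem_op (R : realType) (d : nat) (g : 'rV[R]_d -> 'M[R]_d)
  (y X Y Z : 'rV[R]_d) : 'rV[R]_d :=
  curvature_field g (fun=> X) (fun=> Y) (fun=> Z) y.

Definition wedge (R : realType) (d : nat) (A : tensor2 R d)
  (X Y Z : 'rV[R]_d) : 'rV[R]_d := A Y Z *: X - A X Z *: Y.

Definition ricci (R : realType) (d : nat) (g : 'rV[R]_d -> 'M[R]_d)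
  (y : 'rV[R]_d) : tensor2 R d := fun X Y =>
  \tr (lin1_mx (fun Z => riem_op g y Z X Y)).

(* The vector such that g(ricci_op X, Y) = S(X, Y) for all Y. *)
Definition ricci_op (R : realType) (d : nat) (g : 'rV[R]_d -> 'M[R]_d)
  (y X : 'rV[R]_d) : 'rV[R]_d :=
  (\row_j ricci g y X (delta_mx 0 j)) *m invmx (g y).

Definition scalar_curv (R : realType) (d : nat) (g : 'rV[R]_d -> 'M[R]_d)
  (y : 'rV[R]_d) : R := \tr (lin1_mx (ricci_op g y)).

Definition weyl_op (R : realType) (d : nat) (g : 'rV[R]_d -> 'M[R]_d)
  (y X Y Z : 'rV[R]_d) : 'rV[R]_d :=
  riem_op g y X Y Z
  - (d%:R - 2)^-1 *:
    (wedge (metric g y) X (ricci_op g y Y) Z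
     + wedge (metric g y) (ricci_op g y X) Y Z
     - (scalar_curv g y / (d%:R - 1)) *: wedge (metric g y) X Y Z).

Definition tensor_G (R : realType) (d : nat) (g : 'rV[R]_d -> 'M[R]_d)
  (y : 'rV[R]_d) : tensor4 R d := fun X1 X2 X3 X4 =>
  metric g y (wedge (metric g y) X1 X2 X3) X4.

Definition tensor_R (R : realType) (d : nat) (g : 'rV[R]_d -> 'M[R]_d)
  (y : 'rV[R]_d) : tensor4 R d := fun X1 X2 X3 X4 =>
  metric g y (riem_op g y X1 X2 X3) X4.

Definition tensor_C (R : realType) (d : nat) (g : 'rV[R]_d -> 'M[R]_d)
  (y : 'rV[R]_d) : tensor4 R d := fun X1 X2 X3 X4 =>
  metric g y (weyl_op g y X1 X2 X3) X4.

(* B . T for a (0,4)-tensor T and a field of endomorphisms B(X, Y). *)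
Definition op_dot (R : realType) (d : nat)
  (B : 'rV[R]_d -> 'rV[R]_d -> 'rV[R]_d -> 'rV[R]_d) (T : tensor4 R d)
  (X1 X2 X3 X4 X Y : 'rV[R]_d) : R :=
  - (T (B X Y X1) X2 X3 X4 + T X1 (B X Y X2) X3 X4
     + T X1 X2 (B X Y X3) X4 + T X1 X2 X3 (B X Y X4)).

Definition tachibana (R : realType) (d : nat) (A : tensor2 R d)
  (T : tensor4 R d) := op_dot (wedge A) T.

Definition R_dot_C (R : realType) (d : nat) (g : 'rV[R]_d -> 'M[R]_d)
  (y : 'rV[R]_d) := op_dot (riem_op g y) (tensor_C g y).

Definition C_dot_R (R : realType) (d : nat) (g : 'rV[R]_d -> 'M[R]_d)
  (y : 'rV[R]_d) := op_dot (weyl_op g y) (tensor_R g y).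

Definition Q_S_R (R : realType) (d : nat) (g : 'rV[R]_d -> 'M[R]_d)
  (y : 'rV[R]_d) := tachibana (ricci g y) (tensor_R g y).

Definition einstein_at (R : realType) (d : nat) (g : 'rV[R]_d -> 'M[R]_d)
  (y : 'rV[R]_d) : Prop :=
  forall X Y, ricci g y X Y = scalar_curv g y / d%:R * metric g y X Y.

Definition einstein (R : realType) (d : nat) (M : smoothManifold R d)
  (g : semiRiemMetric M) : Prop :=
  forall c, atlas c -> forall x, chart_dom c x -> einstein_at (g c) (c x).

(** * Warped products

  The metric of Mbar x_F N in the product of a chart c of Mbar and a chart d
  of N; coordinates of the base come first. *)

Definition warped_metric (R : realType) (p q : nat)
  (Mbar : smoothManifold R p) (gbar : semiRiemMetric Mbar) (F : Mbar -> R)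
  (N : smoothManifold R q) (gt : semiRiemMetric N)
  (c : chart R p Mbar) (d : chart R q N) (y : 'rV[R]_(p + q)) :
  'M[R]_(p + q) :=
  block_mx (gbar c (lsubmx y)) 0
           0 (F (chart_inv c (lsubmx y)) *: gt d (rsubmx y)).

Definition prod_coord (R : realType) (p q : nat) (M N : Type)
  (c : chart R p M) (d : chart R q N) (z : M * N) : 'rV[R]_(p + q) :=
  row_mx (c z.1) (d z.2).

Definition prod_dom (R : realType) (p q : nat) (M N : Type)
  (c : chart R p M) (d : chart R q N) : set (M * N) :=
  chart_dom c `*` chart_dom d.

(* The sets U (where Q(S,R) <> 0), U_S and U_C of a warped product, each
   intersected with the domain of the product chart c x d. *)
Section WarpedSets.
Variables (R : realType) (p q : nat).
Variables (Mbar : smoothManifold R p) (gbar : semiRiemMetric Mbar).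
Variables (F : Mbar -> R) (N : smoothManifold R q) (gt : semiRiemMetric N).
Variables (c : chart R p Mbar) (d : chart R q N).

Let g := warped_metric gbar F gt c d.

Definition set_U : set (Mbar * N) := [set z | prod_dom c d z /\
  exists X1 X2 X3 X4 X Y, Q_S_R g (prod_coord c d z) X1 X2 X3 X4 X Y != 0].

Definition set_US : set (Mbar * N) := [set z | prod_dom c d z /\
  ~ einstein_at g (prod_coord c d z)].

Definition set_UC : set (Mbar * N) := [set z | prod_dom c d z /\
  exists X1 X2 X3 X4, tensor_C g (prod_coord c d z) X1 X2 X3 X4 != 0].

End WarpedSets.

(** * Generalized Robertson-Walker spacetimes *)

(* A chart x^1 of a one-dimensional manifold, with connected domain, in which
   gbar_11 = -1. *)
Definition time_coordinate (R : realType) (Mbar : smoothManifold R 1)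
  (gbar : semiRiemMetric Mbar) (c : chart R 1 Mbar) : Prop :=
  [/\ atlas c, connected (chart_dom c) &
      forall y, chart_img c y -> gbar c y 0 0 = -1].

Definition grw_spacetime (R : realType) (n : nat) (Mbar : smoothManifold R 1)
  (gbar : semiRiemMetric Mbar) (F : Mbar -> R)
  (N : smoothManifold R n.-1) (gt : semiRiemMetric N) : Prop :=
  [/\ (4 <= n)%N,
      (forall t : Mbar, exists2 c, time_coordinate gbar c & chart_dom c t),
      smooth_function F,
      (forall t, 0 < F t) &
      riemannian gt].

(** * Components in a chart of the fiber *)

Definition ricci_comp (R : realType) (d : nat) (g : 'rV[R]_d -> 'M[R]_d)
  (y : 'rV[R]_d) (i j : 'I_d) : R := ricci g y (delta_mx 0 i) (delta_mx 0 j).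

Definition riem_comp (R : realType) (d : nat) (g : 'rV[R]_d -> 'M[R]_d)
  (y : 'rV[R]_d) (i j k l : 'I_d) : R :=
  tensor_R g y (delta_mx 0 i) (delta_mx 0 j) (delta_mx 0 k) (delta_mx 0 l).

Definition G_comp (R : realType) (d : nat) (g : 'rV[R]_d -> 'M[R]_d)
  (y : 'rV[R]_d) (i j k l : 'I_d) : R :=
  tensor_G g y (delta_mx 0 i) (delta_mx 0 j) (delta_mx 0 k) (delta_mx 0 l).

(* S_i^e = g^{e k} S_{i k} *)
Definition ricci_mixed (R : realType) (d : nat) (g : 'rV[R]_d -> 'M[R]_d)
  (y : 'rV[R]_d) (i e : 'I_d) : R :=
  \sum_(k < d) invmx (g y) e k * ricci_comp g y i k.

(* Main.v *)
Require Import Defs.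
From HB Require Import structures.
From mathcomp Require Import all_boot all_order all_algebra.
From mathcomp Require Import all_classical all_reals all_analysis.
From mathcomp Require Import ring lra.
Import Order.TTheory GRing.Theory Num.Theory.
Import numFieldNormedType.Exports.

Set Implicit Arguments.
Unset Strict Implicit.
Unset Printing Implicit Defensive.

Local Open Scope classical_set_scope.
Local Open Scope ring_scope.

(* On a warped product [- dt^2 + phi gam] put [w = phi'^2 / (4 phi)] and
   [u = phi'' / 2 - w], so that [sqrt phi] is affine iff [u = 0]; let [r] be the
   traceless Ricci operator of the fiber and [m = (n - 2) L u].  The components
   of the condition with one time direction on each side, traced once, give
   [(r + theta) (r - m) = 0] with [theta = kt / (n - 1) + (n - 2) (w - u)], and
   those with the pair of spatial directions on one side give
   [R . S0 = (m - w) Q(gam, S0)] for the traceless Ricci tensor [S0] of the fiber.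
   Over a point where [r <> 0], the numbers [m - theta], [m theta] and [w - m] are
   therefore independent of [t] as long as [u <> 0]; then [w] solves a fixed
   quadratic equation, so [0 = w' = phi' u / phi], whence [phi' = 0] and [u = 0], a
   contradiction.  Since the fiber is not Einstein, [u = 0] for all [t], and [phi]
   is the square of an affine function.  At any point of [U] the operator [r] now
   satisfies [r (r + theta) = 0]; being traceless and self-adjoint for a definite
   metric it vanishes, so the condition reduces to [Q(S,R) = (n - 2) L Q(S,R)] and
   the identity for the fiber is trivial. *)

(** * Partial derivatives *)

(** The obstacle is that [L] is an arbitrary function, so [m] cannot be differentiated in time. One
    fiber point is therefore kept fixed, where everything built from the fiber is constant, and [m]
    is eliminated algebraically: [(m + theta)^2 = (m - theta)^2 + 4 m theta] is constant, and since
    [w - m] is constant, [m + theta] is [2 w] plus a constant. Only [w], a smooth function of the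
    metric, is ever differentiated. The condition is given only where [Q(S,R) <> 0]. This does not
    hinder the argument, because [Q(S,R) = 0] together with [u <> 0] already forces [r = 0]. A
    single fiber point with [r <> 0] is enough, because [u] depends on time alone. The factor
    [n - 2] in [m] arises from writing [C = R - E / (n - 2)]: the two copies of [R . R] cancel, and
    [R . C - C . R] becomes [(E . R - R . E) / (n - 2)]. *)

Section Directional.
Variables (R : realType) (d : nat).
Implicit Types (f g : 'rV[R]_d -> R) (X Y y : 'rV[R]_d) (O : set 'rV[R]_d).

Definition pderivable f y := forall i : 'I_d, derivable f y (delta_mx 0 i).

(** Built from the partial derivatives rather than from ['D_X]: [smooth_on] only provides
    derivatives along the basis vectors, and linearity in [X] then holds for every [f]. *)
Definition dirder X f : 'rV[R]_d -> R := fun y => \sum_i X 0 i * partial i f y.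

Lemma pderivable_near f g y : (\near y, f y = g y) ->
  pderivable f y -> pderivable g y.
Proof. by move=> fg df i; apply: near_eq_derivable (df i). Qed.

Lemma pderivable_cst (c : R) y : pderivable (fun=> c) y.
Proof. by move=> i; apply: derivable_cst. Qed.

Lemma pderivableD f g y : pderivable f y -> pderivable g y ->
  pderivable (fun z => f z + g z) y.
Proof. by move=> df dg i; apply: derivableD. Qed.

Lemma pderivableM f g y : pderivable f y -> pderivable g y ->
  pderivable (fun z => f z * g z) y.
Proof. by move=> df dg i; apply: derivableM. Qed.

Lemma pderivableV f y : f y != 0 -> pderivable f y ->
  pderivable (fun z => (f z)^-1) y.
Proof. by move=> f0 df i; apply: derivableV. Qed.

Lemma pderivable_sum (I : Type) (r : seq I) (P : pred I)
    (F : I -> 'rV[R]_d -> R) y :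
  (forall i, P i -> pderivable (F i) y) ->
  pderivable (fun z => \sum_(i <- r | P i) F i z) y.
Proof.
move=> dF; elim: r => [|i r IH].
  under eq_fun do rewrite big_nil; exact: pderivable_cst.
under eq_fun do rewrite big_cons.
case: (P i) (@dF i) => [dFi|_]; last exact: IH.
by apply: pderivableD IH; apply: dFi.
Qed.

Lemma pderivable_prod (I : Type) (r : seq I) (P : pred I)
    (F : I -> 'rV[R]_d -> R) y :
  (forall i, P i -> pderivable (F i) y) ->
  pderivable (fun z => \prod_(i <- r | P i) F i z) y.
Proof.
move=> dF; elim: r => [|i r IH].
  under eq_fun do rewrite big_nil; exact: pderivable_cst.
under eq_fun do rewrite big_cons.
case: (P i) (@dF i) => [dFi|_]; last exact: IH.
by apply: pderivableM IH; apply: dFi.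
Qed.

Lemma pderivable_det (m : nat) (A : 'rV[R]_d -> 'M[R]_m) y :
  (forall i j, pderivable (fun z => A z i j) y) ->
  pderivable (fun z => \det (A z)) y.
Proof.
move=> dA; apply: pderivable_sum => s _.
apply: pderivableM; first exact: pderivable_cst.
by apply: pderivable_prod => i _; apply: dA.
Qed.

(** Cramer's rule. Invertibility is required on a neighborhood because [invmx] is the identity on
    singular matrices, where the cofactor formula does not describe it. *)
Lemma pderivable_invmx (m : nat) (A : 'rV[R]_d -> 'M[R]_m) y i j :
  (forall i j, pderivable (fun z => A z i j) y) ->
  (\near y, A y \in unitmx) -> pderivable (fun z => invmx (A z) i j) y.
Proof.
move=> dA uA.
apply: (@pderivable_near (fun z => (\det (A z))^-1 * cofactor (A z) j i)).
  by near=> z; rewrite /invmx (near uA z) // !mxE.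
apply: pderivableM.
  apply: pderivableV; last exact: pderivable_det.
  by have := nbhs_singleton uA; rewrite unitmxE unitfE.
apply: pderivableM; first exact: pderivable_cst.
apply: pderivable_det => k l.
by under eq_fun do rewrite !mxE; apply: dA.
Unshelve. all: by end_near. Qed.

Lemma dirder_near X f g y : (\near y, f y = g y) ->
  dirder X f y = dirder X g y.
Proof.
by move=> fg; apply: eq_bigr => i _; congr (_ * _); apply: near_eq_derive.
Qed.

Lemma dirder_cst X (c : R) y : dirder X (fun=> c) y = 0.
Proof.
rewrite /dirder big1 // => i _; rewrite /partial.
by have -> := derive_cst c y (delta_mx 0 i); rewrite mulr0.
Qed.

Lemma dirderD X f g y : pderivable f y -> pderivable g y ->
  dirder X (fun z => f z + g z) y = dirder X f y + dirder X g y.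
Proof.
move=> df dg; rewrite /dirder -big_split; apply: eq_bigr => i _ /=.
by rewrite /partial -mulrDr; congr (_ * _); apply: deriveD.
Qed.

Lemma dirderM X f g y : pderivable f y -> pderivable g y ->
  dirder X (fun z => f z * g z) y = f y * dirder X g y + g y * dirder X f y.
Proof.
move=> df dg; rewrite /dirder !mulr_sumr -big_split; apply: eq_bigr => i _ /=.
rewrite !(mulrCA _ (X 0 i)) -mulrDr; congr (_ * _).
exact: (deriveM (df i) (dg i)).
Qed.

Lemma dirderZ X (c : R) f y : pderivable f y ->
  dirder X (fun z => c * f z) y = c * dirder X f y.
Proof.
move=> df; rewrite (dirderM _ (@pderivable_cst c y) df) dirder_cst.
by rewrite mulr0 addr0.
Qed.

Lemma dirderV X f y : f y != 0 -> pderivable f y ->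
  dirder X (fun z => (f z)^-1) y = - (f y) ^- 2 * dirder X f y.
Proof.
move=> f0 df; rewrite /dirder mulr_sumr; apply: eq_bigr => i _.
by rewrite mulrCA; congr (_ * _); apply: (deriveV f0 (df i)).
Qed.

Lemma dirderZr X (c : R) f y : pderivable f y ->
  dirder X (fun z => f z * c) y = dirder X f y * c.
Proof.
by move=> df; under eq_fun do rewrite mulrC; rewrite dirderZ // mulrC.
Qed.

Lemma dirder_sum X (I : Type) (r : seq I) (P : pred I)
    (F : I -> 'rV[R]_d -> R) y :
  (forall i, P i -> pderivable (F i) y) ->
  dirder X (fun z => \sum_(i <- r | P i) F i z) y
  = \sum_(i <- r | P i) dirder X (F i) y.
Proof.
move=> dF; elim: r => [|i r IH].
  by under eq_fun do rewrite big_nil; rewrite big_nil dirder_cst.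
under eq_fun do rewrite big_cons; rewrite big_cons; case: ifP => // Pi.
rewrite dirderD ?IH //; first exact: dF.
exact: pderivable_sum.
Qed.

Lemma dirder_linear f y : linear_for *%R (fun X => dirder X f y).
Proof.
move=> a X Y; rewrite /dirder mulr_sumr -big_split; apply: eq_bigr => i _ /=.
by rewrite !mxE mulrDl mulrA.
Qed.

End Directional.

(** * Derivatives of a function composed with a linear map *)

Section Pullback.
Variables (R : realType) (V V' : normedModType R) (h : {linear V -> V'}).

(** The two difference quotients are the same function, so no differentiability is involved. *)
Lemma derive_comp_linear (f : V' -> R) y v :
  'D_v (f \o h) y = 'D_(h v) f (h y).
Proof.
rewrite /derive; set k := (fun _ => _); set k' := (fun _ => _).
suff -> : k = k' by [].
by apply/funext => s; rewrite /k /k' /= [h (_ + _)]linearD [h (_ *: _)]linearZ.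
Qed.

Lemma derivable_comp_linear (f : V' -> R) y v :
  derivable f (h y) (h v) -> derivable (f \o h) y v.
Proof.
rewrite /derivable; set k := (fun _ => _); set k' := (fun _ => _).
suff -> : k = k' by [].
by apply/funext => s; rewrite /k /k' /= [h (_ + _)]linearD [h (_ *: _)]linearZ.
Qed.

End Pullback.

(** * Sums and constant multiples of smooth functions *)

Section Smooth.
Variables (R : realType) (d : nat) (O : set 'rV[R]_d).
Hypothesis openO : open O.
Implicit Types (f g : 'rV[R]_d -> R) (X Y y : 'rV[R]_d).

Lemma near_open y : O y -> \near y, O y.
Proof. by move=> Oy; apply: open_nbhs_nbhs. Qed.

Lemma smooth_pderivable f y : smooth_on O f -> O y -> pderivable f y.
Proof. by move=> sf Oy; have [_] := sf [::] y Oy. Qed.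

Lemma smooth_continuous f y : smooth_on O f -> O y -> {for y, continuous f}.
Proof. by move=> sf Oy; have [] := sf [::] y Oy. Qed.

Lemma smooth_partial f i : smooth_on O f -> smooth_on O (partial i f).
Proof.
move=> sf s y Oy; have := sf (rcons s i) y Oy.
by rewrite /iter_partial -cats1 foldr_cat.
Qed.

Lemma smooth_cst (c : R) : smooth_on O (fun=> c).
Proof.
have E (s : seq 'I_d) : exists c', iter_partial s (fun=> c) = fun=> c'.
  elim: s => [|i s [c' IH]]; first by exists c.
  by exists 0; rewrite /iter_partial /= -/(iter_partial s _) IH;
     apply/funext => z; apply: derive_cst.
move=> s y _; have [c' ->] := E s; split; first exact: cst_continuous.
exact: pderivable_cst.
Qed.

Lemma smoothD f g : smooth_on O f -> smooth_on O g ->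
  smooth_on O (fun z => f z + g z).
Proof.
move=> sf sg.
(* Equality of the iterated derivatives holds on [O] only; openness makes it hold near each point,
   so it survives one more derivative. *)
have E (s : seq 'I_d) y : O y -> iter_partial s (fun z => f z + g z) y
    = iter_partial s f y + iter_partial s g y.
  elim: s y => [//|i s IH] y Oy; rewrite /iter_partial /= -!/(iter_partial s _).
  rewrite /partial (@near_eq_derive _ _ _ _
    (iter_partial s f + iter_partial s g)); last first.
    by near=> z; apply: IH; near: z; apply: near_open.
  have [_ df] := sf s y Oy; have [_ dg] := sg s y Oy.
  exact: (deriveD (df i) (dg i)).
move=> s y Oy.
have nE : \near y, iter_partial s f y + iter_partial s g y
    = iter_partial s (fun z => f z + g z) y.
  by near=> z; rewrite E //; near: z; apply: near_open.
have [cf df] := sf s y Oy; have [cg dg] := sg s y Oy; split.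
  rewrite /prop_for /continuous_at E //; apply: cvg_trans (near_eq_cvg nE) _.
  exact: continuousD.
exact: pderivable_near nE (pderivableD df dg).
Unshelve. all: by end_near. Qed.

Lemma smoothZ (c : R) f : smooth_on O f -> smooth_on O (fun z => c * f z).
Proof.
move=> sf.
have E (s : seq 'I_d) y : O y -> iter_partial s (fun z => c * f z) y
    = c * iter_partial s f y.
  elim: s y => [//|i s IH] y Oy; rewrite /iter_partial /= -!/(iter_partial s _).
  rewrite /partial (@near_eq_derive _ _ _ _ (c *: iter_partial s f)); last first.
    by near=> z; apply: IH; near: z; apply: near_open.
  have [_ df] := sf s y Oy; exact: (deriveZ c (df i)).
move=> s y Oy.
have nE : \near y, c * iter_partial s f y
    = iter_partial s (fun z => c * f z) y.
  by near=> z; rewrite E //; near: z; apply: near_open.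
have [cf df] := sf s y Oy; split.
  rewrite /prop_for /continuous_at E //; apply: cvg_trans (near_eq_cvg nE) _.
  by apply: cvgM => //; apply: cvg_cst.
exact: pderivable_near nE (pderivableM (@pderivable_cst _ _ c y) df).
Unshelve. all: by end_near. Qed.

Lemma smooth_sum (I : Type) (r : seq I) (P : pred I)
    (F : I -> 'rV[R]_d -> R) :
  (forall i, P i -> smooth_on O (F i)) ->
  smooth_on O (fun z => \sum_(i <- r | P i) F i z).
Proof.
move=> dF; elim: r => [|i r IH].
  under eq_fun do rewrite big_nil; exact: smooth_cst.
under eq_fun do rewrite big_cons.
case: (P i) (@dF i) => [dFi|_]; last exact: IH.
by apply: smoothD IH; apply: dFi.
Qed.

End Smooth.

(** * Symmetry of second derivatives *)

Section Schwarz.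
Variables (R : realType) (d : nat).
Implicit Types (f : 'rV[R]_d -> R) (y e : 'rV[R]_d).

Lemma derivable_line f y e (t : R) : derivable f (y + t *: e) e ->
  is_derive t 1 (fun t => f (y + t *: e)) ('D_e f (y + t *: e)).
Proof.
move=> df.
have E : (fun h : R => h^-1 *:
    (((fun t => f (y + t *: e)) \o shift t) (h *: 1) - f (y + t *: e)))
  = (fun h : R => h^-1 *:
    ((f \o shift (y + t *: e)) (h *: e) - f (y + t *: e))).
  apply/funext => h /=; congr (_ *: (f _ - _)).
  by rewrite scalerDl [h *: 1]mulr1 addrCA.
by split; rewrite /derivable /derive E.
Qed.

Lemma MVT_line f y e (a b : R) : a < b ->
  (forall t, a <= t <= b -> derivable f (y + t *: e) e) ->
  exists2 c, a < c < b &
    f (y + b *: e) - f (y + a *: e) = 'D_e f (y + c *: e) * (b - a).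
Proof.
move=> ab df.
have [||c cab E] := @MVT R (fun t => f (y + t *: e))
  (fun t => 'D_e f (y + t *: e)) a b ab.
- move=> t; rewrite in_itv /= => /andP[at_ tb]; apply: derivable_line.
  by apply: df; rewrite !ltW.
- apply: derivable_within_continuous => t; rewrite in_itv /= => tab.
  by have [] := derivable_line (df t tab).
by exists c => //; rewrite in_itv in cab.
Qed.

(* The second difference of [f] over the square of side [h] at [y] is [h^2]
   times either mixed derivative at some point of the square. *)
Lemma second_difference f y (u v : 'rV[R]_d) (h : R) : 0 < h ->
  (forall s t, 0 <= s <= h -> 0 <= t <= h ->
     [/\ derivable f (y + s *: u + t *: v) u &
         derivable ('D_u f) (y + s *: u + t *: v) v]) ->
  exists s t, [/\ 0 < s < h, 0 < t < h &
    f (y + h *: u + h *: v) - f (y + h *: u) - f (y + h *: v) + f y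
    = 'D_v ('D_u f) (y + s *: u + t *: v) * h ^+ 2].
Proof.
move=> h0 df.
pose k z := f (z + h *: v) - f z.
have dkv s : 0 <= s <= h -> derivable (f \o shift (h *: v)) (y + s *: u) u /\
    'D_u (f \o shift (h *: v)) (y + s *: u) = 'D_u f (y + s *: u + h *: v).
  move=> sh.
  have [|d1 _] := df s h sh; first by rewrite lexx ltW.
  have E : (fun a : R => a^-1 *: (((f \o shift (h *: v)) \o shift (y + s *: u))
       (a *: u) - (f \o shift (h *: v)) (y + s *: u)))
     = (fun a : R => a^-1 *: ((f \o shift (y + s *: u + h *: v)) (a *: u)
        - f (y + s *: u + h *: v))).
    by apply/funext => a /=; rewrite !addrA.
  by split; [move: d1|]; rewrite /derivable /derive E.
have df0 s : 0 <= s <= h -> derivable f (y + s *: u) u.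
  have h00 : 0 <= (0 : R) <= h by rewrite lexx ltW.
  by move=> sh; have [+ _] := df s 0 sh h00; rewrite scale0r addr0.
have [|s s0h E1] := @MVT_line k y u 0 h h0.
  move=> s sh; have [d1 _] := dkv s sh.
  exact: (@derivableB _ _ _ (f \o shift (h *: v)) f _ _ d1 (df0 s sh)).
have s0h' : 0 <= s <= h by case/andP: s0h => *; rewrite !ltW.
have [|t t0h E2] := @MVT_line ('D_u f) (y + s *: u) v 0 h h0.
  by move=> t th; have [] := df s t s0h' th.
exists s, t; split=> //.
move: E1; rewrite scale0r addr0 subr0 /k.
have [d1 d2] := dkv s s0h'.
have -> : 'D_u (fun z => f (z + h *: v) - f z) (y + s *: u)
    = 'D_u f (y + s *: u + h *: v) - 'D_u f (y + s *: u).
  rewrite -d2.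
  exact: (@deriveB _ _ _ (f \o shift (h *: v)) f _ _ d1 (df0 s s0h')).
move: E2; rewrite scale0r addr0 subr0 => -> E.
by rewrite expr2 mulrA -E; ring.
Qed.

Lemma partial_comm (O : set 'rV[R]_d) f (i j : 'I_d) y : open O -> O y ->
  smooth_on O f -> partial i (partial j f) y = partial j (partial i f) y.
Proof.
move=> openO Oy sf; apply/eqP; rewrite -subr_eq0 -normr_le0.
apply/ler_addgt0Pr => e e0; rewrite add0r.
have e20 : 0 < e / 2 by rewrite divr_gt0.
have c1 : {for y, continuous (partial i (partial j f))}.
  by have [] := sf [:: i; j] y Oy.
have c2 : {for y, continuous (partial j (partial i f))}.
  by have [] := sf [:: j; i] y Oy.
have := near_open openO Oy.
move: c1 => /cvgrPdist_lt /(_ _ e20) c1.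
move: c2 => /cvgrPdist_lt /(_ _ e20) c2 nO.
have : nbhs y [set z | O z /\
    (`|partial i (partial j f) y - partial i (partial j f) z| < e / 2 /\
     `|partial j (partial i f) y - partial j (partial i f) z| < e / 2)].
  exact: filterI nO (filterI c1 c2).
move=> /nbhs_ballP[r /= r0 Hr].
(* Points of the square differ from [y] by at most [2 * h < r] in each coordinate, so the whole
   square lies in the ball. *)
pose h := r / 4.
have h0 : 0 < h by rewrite divr_gt0.
have B s t (k l : 'I_d) : 0 <= s <= h -> 0 <= t <= h ->
    ball y r (y + s *: delta_mx 0 k + t *: delta_mx 0 l).
  move=> /andP[s0 sh] /andP[t0 th]; split=> // a b.
  rewrite !mxE -ball_normE /ball_ /= -addrA opprD addNKr normrN.
  apply: le_lt_trans (ler_normD _ _) _; rewrite !normrM (ger0_norm s0) (ger0_norm t0).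
  have N (c : bool) : `|(c%:R : R)| <= 1 by case: c; rewrite ?normr1 ?normr0.
  apply: (@le_lt_trans _ _ (s + t)).
    by apply: lerD; apply: ler_piMr.
  by rewrite /h in sh th *; lra.
have D s t (k l : 'I_d) : 0 <= s <= h -> 0 <= t <= h ->
   derivable f (y + s *: delta_mx 0 k + t *: delta_mx 0 l) (delta_mx 0 k) /\
   derivable (partial k f) (y + s *: delta_mx 0 k + t *: delta_mx 0 l) (delta_mx 0 l).
  move=> sh th; have [Oz _] := Hr _ (B s t k l sh th); split.
    exact: (smooth_pderivable sf Oz).
  exact: (smooth_pderivable (smooth_partial k sf) Oz).
have [|s [t [s0 t0 E1]]] := @second_difference f y (delta_mx 0 i) (delta_mx 0 j) h h0.
  by move=> s t sh th; have [d1 d2] := D s t i j sh th; exact: conj d1 d2.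
have [|s' [t' [s'0 t'0 E2]]] := @second_difference f y (delta_mx 0 j) (delta_mx 0 i) h h0.
  by move=> s' t' sh th; have [d1 d2] := D s' t' j i sh th; exact: conj d1 d2.
have W (x : R) : 0 < x < h -> 0 <= x <= h by case/andP=> *; rewrite !ltW.
have [_ [_ B1]] := Hr _ (B s t i j (W _ s0) (W _ t0)).
have [_ [B2 _]] := Hr _ (B s' t' j i (W _ s'0) (W _ t'0)).
(* The second difference is symmetric in the two directions, so the two mixed derivatives agree, at
   two possibly different points of the square; each is within [e / 2] of its value at [y]. *)
have E : partial j (partial i f) (y + s *: delta_mx 0 i + t *: delta_mx 0 j)
  = partial i (partial j f) (y + s' *: delta_mx 0 j + t' *: delta_mx 0 i).
  apply: (@mulIf _ (h ^+ 2)); first by rewrite sqrf_eq0 gt_eqF.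
  refine (etrans (esym E1) (etrans _ E2)).
  by rewrite [y + _ + _]addrAC; congr (_ + _); apply: addrAC.
move: B1 B2; rewrite /= E.
set p := partial i _ (_ + _); set A := partial j _ y; set A' := partial i _ y.
move=> B1 B2; apply/ltW.
have -> : A' - A = (A' - p) - (A - p) by rewrite opprB addrA subrK.
apply: le_lt_trans (ler_normB _ _) _.
rewrite [e]splitr; exact: (ltrD B2 B1).
Qed.

Lemma dirder_comm (O : set 'rV[R]_d) f X Y y : open O -> O y ->
  smooth_on O f -> dirder X (dirder Y f) y = dirder Y (dirder X f) y.
Proof.
move=> openO Oy sf.
have E Z T : dirder Z (dirder T f) y
    = \sum_i \sum_j Z 0 i * T 0 j * partial i (partial j f) y.
  rewrite [in LHS]/(dirder T) dirder_sum; last first.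
    move=> j _; apply: pderivableM; first exact: pderivable_cst.
    exact: smooth_pderivable (smooth_partial j sf) Oy.
  rewrite [RHS]exchange_big; apply: eq_bigr => j _ /=; rewrite dirderZ; last first.
    exact: smooth_pderivable (smooth_partial j sf) Oy.
  by rewrite mulr_sumr; apply: eq_bigr => i _; ring.
rewrite !E exchange_big; apply: eq_bigr => i _; apply: eq_bigr => j _.
by rewrite (partial_comm _ _ openO Oy sf); ring.
Qed.

End Schwarz.

(** * The Levi-Civita connection in a chart *)

Section Bilinear.
Variables (R : realType) (d : nat) (g : 'rV[R]_d -> 'M[R]_d).
Implicit Types (X Y Z W V y : 'rV[R]_d).

Lemma metricDl y X Y Z : metric g y (X + Y) Z = metric g y X Z + metric g y Y Z.
Proof. by rewrite /metric !mulmxDl mxE. Qed.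

Lemma metricZl y a X Y : metric g y (a *: X) Y = a * metric g y X Y.
Proof. by rewrite /metric -!scalemxAl mxE. Qed.

Lemma metricNl y X Y : metric g y (- X) Y = - metric g y X Y.
Proof. by rewrite -scaleN1r metricZl mulN1r. Qed.

Lemma metric0l y X : metric g y 0 X = 0.
Proof. by rewrite /metric !mul0mx mxE. Qed.

Lemma metricDr y X Y Z : metric g y Z (X + Y) = metric g y Z X + metric g y Z Y.
Proof. by rewrite /metric linearD mulmxDr mxE. Qed.

Lemma metricZr y a X Y : metric g y Y (a *: X) = a * metric g y Y X.
Proof. by rewrite /metric linearZ -scalemxAr mxE. Qed.

Lemma metricNr y X Y : metric g y Y (- X) = - metric g y Y X.
Proof. by rewrite -scaleN1r metricZr mulN1r. Qed.

Lemma metric0r y X : metric g y X 0 = 0.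
Proof. by rewrite /metric linear0 mulmx0 mxE. Qed.

Definition metric_lin :=
  (metricDl, metricZl, metricNl, metric0l, metricDr, metricZr, metricNr, metric0r).

Lemma metricE y X Y :
  metric g y X Y = \sum_j \sum_k X 0 j * g y j k * Y 0 k.
Proof.
rewrite /metric mxE exchange_big; apply: eq_bigr => k _ /=.
by rewrite !mxE mulr_suml.
Qed.

Lemma metric_sym y X Y : (g y)^T = g y -> metric g y X Y = metric g y Y X.
Proof.
move=> gs; rewrite /metric -[RHS](_ : ((Y *m g y *m X^T)^T) 0 0 = _); last by rewrite mxE.
by rewrite !trmx_mul trmxK gs mulmxA.
Qed.

Lemma metric_delta y X k : metric g y X (delta_mx 0 k) = (X *m g y) 0 k.
Proof.
by rewrite /metric trmx_delta -colE mxE.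
Qed.

Lemma metric_delta2 y j k :
  metric g y (delta_mx 0 j) (delta_mx 0 k) = g y j k.
Proof. by rewrite metric_delta -rowE mxE. Qed.

Lemma metric_inj y X Y : g y \in unitmx ->
  (forall Z, metric g y X Z = metric g y Y Z) -> X = Y.
Proof.
move=> gu E; apply: (can_inj (mulmxK gu)); apply/rowP => k.
by rewrite -!metric_delta E.
Qed.

(** The covariant derivative of the field with constant components [Y]. Keeping it as a bilinear map
    of vectors lets the warped product be computed on time and fiber parts instead of on indices. *)
Definition Gam y X Y : 'rV[R]_d :=
  \row_k \sum_i X 0 i * \sum_j christoffel g k i j y * Y 0 j.

Definition dGam y X Y Z : 'rV[R]_d :=
  \row_k dirder X (fun z => Gam z Y Z 0 k) y.

Lemma nablaE (X W : 'rV[R]_d -> 'rV[R]_d) y :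
  nabla g X W y
  = (\row_k dirder (X y) (fun z => W z 0 k) y) + Gam y (X y) (W y).
Proof.
apply/rowP => k; rewrite !mxE -big_split; apply: eq_bigr => i _ /=.
by rewrite mulrDr.
Qed.

Lemma nabla_cst Y Z : nabla g (fun=> Y) (fun=> Z) = fun z => Gam z Y Z.
Proof.
apply/funext => z; rewrite nablaE /=.
rewrite [X in X + _](_ : _ = 0) ?add0r //.
by apply/rowP => k; rewrite !mxE dirder_cst.
Qed.

Lemma riem_opE y X Y Z : riem_op g y X Y Z
  = dGam y X Y Z - dGam y Y X Z + Gam y X (Gam y Y Z) - Gam y Y (Gam y X Z).
Proof.
rewrite /riem_op /curvature_field.
have -> : nabla g (lie_bracket (fun=> X) (fun=> Y)) (fun=> Z) y = 0.
  apply/rowP => k; rewrite !mxE big1 // => i _.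
  rewrite !mxE big1 ?mul0r // => j _; rewrite /partial.
  rewrite (_ : 'D_(delta_mx 0 j) (fun=> Y 0 i) y = 0); last exact: derive_cst.
  rewrite (_ : 'D_(delta_mx 0 j) (fun=> X 0 i) y = 0); last exact: derive_cst.
  by rewrite !mulr0 subrr.
rewrite subr0 !nabla_cst !nablaE -/(dGam y X Y Z) -/(dGam y Y X Z).
by rewrite opprD !addrA (addrAC _ _ (- dGam _ _ _ _)).
Qed.

Lemma riem_opC y X Y Z : riem_op g y Y X Z = - riem_op g y X Y Z.
Proof.
rewrite !riem_opE !opprD !opprK; set a := dGam _ _ _ _; set b := dGam _ _ _ _.
by rewrite (addrC a) addrAC.
Qed.

Lemma GamDl y X Y Z : Gam y (X + Y) Z = Gam y X Z + Gam y Y Z.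
Proof.
apply/rowP => k; rewrite !mxE -big_split; apply: eq_bigr => i _ /=.
by rewrite !mxE mulrDl.
Qed.

Lemma GamZl y a X Z : Gam y (a *: X) Z = a *: Gam y X Z.
Proof.
apply/rowP => k; rewrite !mxE mulr_sumr; apply: eq_bigr => i _ /=.
by rewrite !mxE mulrA.
Qed.

Lemma GamDr y X Y Z : Gam y Z (X + Y) = Gam y Z X + Gam y Z Y.
Proof.
apply/rowP => k; rewrite !mxE -big_split; apply: eq_bigr => i _ /=.
rewrite -mulrDr -big_split; congr (_ * _); apply: eq_bigr => j _ /=.
by rewrite !mxE mulrDr.
Qed.

Lemma GamZr y a X Z : Gam y Z (a *: X) = a *: Gam y Z X.
Proof.
apply/rowP => k; rewrite !mxE mulr_sumr; apply: eq_bigr => i _ /=.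
rewrite mulrCA; congr (_ * _); rewrite mulr_sumr; apply: eq_bigr => j _.
by rewrite !mxE mulrCA.
Qed.

Lemma dirder_metric_at X Y Z y :
  (forall j k, pderivable (fun z => g z j k) y) -> dirder X (fun z => metric g z Y Z) y
  = \sum_i \sum_j \sum_k X 0 i * Y 0 j * Z 0 k * partial i (fun z => g z j k) y.
Proof.
move=> dg.
have dgc j k : pderivable (fun z => Y 0 j * g z j k * Z 0 k) y.
  apply: pderivableM; last exact: pderivable_cst.
  by apply: pderivableM; first exact: pderivable_cst.
under [in LHS]eq_fun do rewrite metricE.
rewrite dirder_sum; last by move=> j _; apply: pderivable_sum.
rewrite [RHS]exchange_big; apply: eq_bigr => j _ /=.
rewrite dirder_sum // [RHS]exchange_big; apply: eq_bigr => k _ /=.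
under [in LHS]eq_fun do rewrite mulrAC.
rewrite dirderZ // /dirder mulr_sumr; apply: eq_bigr => i _ /=.
by rewrite !mulrA; congr (_ * _); rewrite mulrAC; congr (_ * _); rewrite mulrC.
Qed.

(** The Koszul formula for fields with constant components, whose brackets vanish. It is stated at
    one point so that it applies to the warped metric, for which partial differentiability of the
    entries is at hand. *)
Lemma koszul_at X Y W y :
  (forall j k, pderivable (fun z => g z j k) y) -> (g y)^T = g y ->
  g y \in unitmx -> metric g y (Gam y X Y) W
  = 2^-1 * (dirder X (fun z => metric g z Y W) y
            + dirder Y (fun z => metric g z X W) y
            - dirder W (fun z => metric g z X Y) y).
Proof.
move=> dg gs gu.
have invC a b : invmx (g y) a b = invmx (g y) b a.
  by rewrite -[in RHS]gs -trmx_inv mxE.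
pose c i j l := partial i (fun z => g z j l) y + partial j (fun z => g z i l) y
  - partial l (fun z => g z i j) y.
(* Lowering the upper index of the Christoffel symbols removes the inverse metric. *)
have low i j l : \sum_k christoffel g k i j y * g y k l = 2^-1 * c i j l.
  transitivity (2^-1 * ((\row_m c i j m) *m invmx (g y) *m g y) 0 l).
    rewrite !mxE mulr_sumr; apply: eq_bigr => k _.
    rewrite /christoffel -mulrA; congr (_ * (_ * _)).
    by rewrite !mxE; apply: eq_bigr => m _; rewrite !mxE invC mulrC.
  by rewrite mulmxKV // mxE.
transitivity (2^-1 * \sum_i \sum_j \sum_l X 0 i * Y 0 j * W 0 l * c i j l).
  rewrite metricE.
  under eq_bigr => k _.
    under eq_bigr => l _ do rewrite !mxE !mulr_suml.
    rewrite exchange_big /=; over.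
  rewrite exchange_big mulr_sumr; apply: eq_bigr => i _ /=.
  transitivity (\sum_k \sum_l \sum_j
      X 0 i * Y 0 j * W 0 l * (christoffel g k i j y * g y k l)).
    apply: eq_bigr => k _; apply: eq_bigr => l _.
    rewrite mulr_sumr !mulr_suml; apply: eq_bigr => j _; ring.
  transitivity (\sum_j \sum_k \sum_l
      X 0 i * Y 0 j * W 0 l * (christoffel g k i j y * g y k l)).
    by rewrite [RHS]exchange_big; apply: eq_bigr => k _; rewrite [RHS]exchange_big.
  rewrite mulr_sumr; apply: eq_bigr => j _ /=.
  rewrite exchange_big mulr_sumr; apply: eq_bigr => l _ /=.
  by rewrite -mulr_sumr low; ring.
rewrite !dirder_metric_at //; congr (_ * _).
rewrite [X in _ = _ + X - _]exchange_big /=.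
rewrite [X in _ = _ - X](_ : _ = \sum_i \sum_j \sum_l
    X 0 i * Y 0 j * W 0 l * partial l (fun z => g z i j) y); last first.
  rewrite exchange_big; apply: eq_bigr => i _ /=.
  rewrite exchange_big; apply: eq_bigr => j _ /=.
  by apply: eq_bigr => l _; congr (_ * _); ring.
rewrite -big_split -sumrB; apply: eq_bigr => i _ /=.
rewrite -big_split -sumrB; apply: eq_bigr => j _ /=.
rewrite -big_split -sumrB; apply: eq_bigr => l _ /=.
by rewrite /c (mulrC (Y 0 j) (X 0 i)) -mulrDr -mulrBr.
Qed.

End Bilinear.

Definition local_metric (R : realType) (d : nat) (O : set 'rV[R]_d)
  (g : 'rV[R]_d -> 'M[R]_d) : Prop :=
  [/\ open O, forall i j, smooth_on O (fun y => g y i j),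
      forall y, O y -> (g y)^T = g y & forall y, O y -> g y \in unitmx].

Section LeviCivita.
Variables (R : realType) (d : nat) (g : 'rV[R]_d -> 'M[R]_d) (O : set 'rV[R]_d).
Hypothesis hg : local_metric O g.

Let openO : open O. Proof. by case: hg. Qed.
Let smooth_g i j : smooth_on O (fun y => g y i j).
Proof. by case: hg. Qed.
Let sym_g y : O y -> (g y)^T = g y. Proof. by case: hg => _ _ + _; apply. Qed.
Let unit_g y : O y -> g y \in unitmx. Proof. by case: hg => _ _ _; apply. Qed.

Implicit Types (X Y Z W V y : 'rV[R]_d).

Lemma smooth_metric X Y : smooth_on O (fun z => metric g z X Y).
Proof.
under eq_fun do rewrite metricE.
apply: smooth_sum => // j _; apply: smooth_sum => // k _.
under eq_fun do rewrite mulrC mulrA; exact: smoothZ.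
Qed.

Lemma koszul X Y W y : O y -> metric g y (Gam g y X Y) W
  = 2^-1 * (dirder X (fun z => metric g z Y W) y
            + dirder Y (fun z => metric g z X W) y
            - dirder W (fun z => metric g z X Y) y).
Proof.
move=> Oy; apply: koszul_at; [|exact: sym_g|exact: unit_g].
by move=> j k; apply: smooth_pderivable Oy.
Qed.

Lemma metric_symO X Y y : O y -> metric g y X Y = metric g y Y X.
Proof. by move=> Oy; apply: metric_sym; apply: sym_g. Qed.

Lemma dirder_metric_sym X Y Z y : O y ->
  dirder X (fun z => metric g z Y Z) y = dirder X (fun z => metric g z Z Y) y.
Proof.
move=> Oy; apply: dirder_near; near=> z; apply: metric_symO.
by near: z; apply: near_open.
Unshelve. all: by end_near. Qed.

Lemma GamC X Y y : O y -> Gam g y X Y = Gam g y Y X.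
Proof.
move=> Oy; apply: (metric_inj (unit_g Oy)) => W.
rewrite (koszul X Y W Oy) (koszul Y X W Oy).
by rewrite (dirder_metric_sym W X Y Oy) [X in X - _]addrC.
Qed.

Lemma metric_compat X Y Z y : O y -> dirder X (fun z => metric g z Y Z) y
  = metric g y (Gam g y X Y) Z + metric g y Y (Gam g y X Z).
Proof.
move=> Oy; rewrite (metric_symO Y) // !koszul //.
rewrite (dirder_metric_sym X Z Y Oy) (dirder_metric_sym Z X Y Oy).
by rewrite (dirder_metric_sym Y X Z Oy); field.
Qed.

Lemma pderivable_christoffel k i j y : O y ->
  pderivable (christoffel g k i j) y.
Proof.
move=> Oy; apply: pderivableM; first exact: pderivable_cst.
apply: pderivable_sum => l _; apply: pderivableM.
  apply: pderivable_invmx => [a b|]; first exact: smooth_pderivable Oy.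
  by near=> z; apply: unit_g; near: z; apply: near_open.
have dp a b c : pderivable (partial a (fun z => g z b c)) y.
  exact: smooth_pderivable (smooth_partial a (smooth_g b c)) Oy.
apply: pderivableD; first exact: pderivableD.
under eq_fun do rewrite -mulN1r.
by apply: pderivableM; first exact: pderivable_cst.
Unshelve. all: by end_near. Qed.

Lemma pderivable_Gam X Y k y : O y -> pderivable (fun z => Gam g z X Y 0 k) y.
Proof.
move=> Oy; under eq_fun do rewrite mxE.
apply: pderivable_sum => i _; apply: pderivableM; first exact: pderivable_cst.
apply: pderivable_sum => j _; apply: pderivableM; last exact: pderivable_cst.
exact: pderivable_christoffel.
Qed.

Lemma dGamDl y X X' Y Z : dGam g y (X + X') Y Z = dGam g y X Y Z + dGam g y X' Y Z.
Proof.
apply/rowP => k; rewrite !mxE.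
by have := dirder_linear (fun z => Gam g z Y Z 0 k) y 1 X X'; rewrite scale1r mul1r.
Qed.

Lemma dGamZl y a X Y Z : dGam g y (a *: X) Y Z = a *: dGam g y X Y Z.
Proof.
apply/rowP => k; rewrite !mxE /dirder mulr_sumr; apply: eq_bigr => i _.
by rewrite mxE mulrA.
Qed.

Lemma dGamDm y X Y Y' Z : O y ->
  dGam g y X (Y + Y') Z = dGam g y X Y Z + dGam g y X Y' Z.
Proof.
move=> Oy; apply/rowP => k; rewrite !mxE -dirderD; try exact: pderivable_Gam.
under [in LHS]eq_fun do rewrite GamDl mxE.
by [].
Qed.

Lemma dGamZm y a X Y Z : O y -> dGam g y X (a *: Y) Z = a *: dGam g y X Y Z.
Proof.
move=> Oy; apply/rowP => k; rewrite !mxE -dirderZ; last exact: pderivable_Gam.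
under [in LHS]eq_fun do rewrite GamZl mxE.
by [].
Qed.

Lemma dGamDr y X Y Z Z' : O y ->
  dGam g y X Y (Z + Z') = dGam g y X Y Z + dGam g y X Y Z'.
Proof.
move=> Oy; apply/rowP => k; rewrite !mxE -dirderD; try exact: pderivable_Gam.
under [in LHS]eq_fun do rewrite GamDr mxE.
by [].
Qed.

Lemma dGamZr y a X Y Z : O y -> dGam g y X Y (a *: Z) = a *: dGam g y X Y Z.
Proof.
move=> Oy; apply/rowP => k; rewrite !mxE -dirderZ; last exact: pderivable_Gam.
under [in LHS]eq_fun do rewrite GamZr mxE.
by [].
Qed.

Lemma dGamC y X Y Z : O y -> dGam g y X Y Z = dGam g y X Z Y.
Proof.
move=> Oy; apply/rowP => k; rewrite !mxE; apply: dirder_near.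
near=> z; rewrite GamC //; near: z; exact: near_open.
Unshelve. all: by end_near. Qed.

Lemma riem_opDl y X X' Y Z : O y ->
  riem_op g y (X + X') Y Z = riem_op g y X Y Z + riem_op g y X' Y Z.
Proof.
move=> Oy; rewrite !riem_opE dGamDl dGamDm // !GamDl GamDr.
apply/rowP => k; rewrite !mxE; ring.
Qed.

Lemma riem_opZl y a X Y Z : O y ->
  riem_op g y (a *: X) Y Z = a *: riem_op g y X Y Z.
Proof.
move=> Oy; rewrite !riem_opE dGamZl dGamZm // !GamZl GamZr.
apply/rowP => k; rewrite !mxE; ring.
Qed.

Lemma riem_opDm y X Y Y' Z : O y ->
  riem_op g y X (Y + Y') Z = riem_op g y X Y Z + riem_op g y X Y' Z.
Proof.
move=> Oy; rewrite (riem_opC g y (Y + Y') X Z) riem_opDl // opprD.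
by rewrite (riem_opC g y Y X Z) (riem_opC g y Y' X Z).
Qed.

Lemma riem_opZm y a X Y Z : O y ->
  riem_op g y X (a *: Y) Z = a *: riem_op g y X Y Z.
Proof.
by move=> Oy; rewrite riem_opC riem_opZl // -scalerN -riem_opC.
Qed.

Lemma riem_opDr y X Y Z Z' : O y ->
  riem_op g y X Y (Z + Z') = riem_op g y X Y Z + riem_op g y X Y Z'.
Proof.
move=> Oy; rewrite !riem_opE !dGamDr // !GamDr.
apply/rowP => k; rewrite !mxE; ring.
Qed.

Lemma riem_opZr y a X Y Z : O y ->
  riem_op g y X Y (a *: Z) = a *: riem_op g y X Y Z.
Proof.
move=> Oy; rewrite !riem_opE !dGamZr // !GamZr.
apply/rowP => k; rewrite !mxE; ring.
Qed.

Lemma bianchi y X Y Z : O y ->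
  riem_op g y X Y Z + riem_op g y Y Z X + riem_op g y Z X Y = 0.
Proof.
move=> Oy; rewrite !riem_opE (dGamC X Z Y) // (dGamC Y X Z) // (dGamC Z Y X) //.
rewrite (GamC Z Y) // (GamC X Z) // (GamC Y X) //.
apply/rowP => k; rewrite !mxE; ring.
Qed.

(** A product rule. The first term freezes [V] at [y], so that [metric_compat], which concerns
    constant vectors, applies to it. *)
Lemma dirder_metricl X (V : 'rV[R]_d -> 'rV[R]_d) W y : O y ->
  (forall k, pderivable (fun z => V z 0 k) y) ->
  dirder X (fun z => metric g z (V z) W) y
  = dirder X (fun z => metric g z (V y) W) y
    + metric g y (\row_k dirder X (fun z => V z 0 k) y) W.
Proof.
move=> Oy dV.
have dg j k : pderivable (fun z => g z j k) y by apply: smooth_pderivable Oy.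
have dW j : pderivable (fun z => \sum_k g z j k * W 0 k) y.
  apply: pderivable_sum => k _; apply: pderivableM => //; exact: pderivable_cst.
have E U z : metric g z U W = \sum_j U 0 j * \sum_k g z j k * W 0 k.
  rewrite metricE; apply: eq_bigr => j _; rewrite mulr_sumr.
  by apply: eq_bigr => k _; rewrite mulrA.
under [in LHS]eq_fun do rewrite E.
under [in RHS]eq_fun do rewrite E.
rewrite dirder_sum; last by move=> j _; apply: pderivableM.
rewrite dirder_sum; last first.
  by move=> j _; apply: pderivableM => //; apply: pderivable_cst.
rewrite E -big_split; apply: eq_bigr => j _ /=.
by rewrite dirderM // dirderZ // !mxE; congr (_ + _); rewrite mulrC.
Qed.

(** Differentiate [g(Z, W)] twice, along [X] and [Y]. The terms in which each factor is hit once are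
    symmetric in [X] and [Y], so the commutator of the two derivatives is the left-hand side, and it
    vanishes by the symmetry of second derivatives. *)
Lemma riem_op_skew y X Y Z W : O y ->
  metric g y (riem_op g y X Y Z) W + metric g y Z (riem_op g y X Y W) = 0.
Proof.
move=> Oy.
have H A B : dirder A (dirder B (fun z => metric g z Z W)) y
   = metric g y (dGam g y A B Z + Gam g y A (Gam g y B Z)) W
   + metric g y (Gam g y B Z) (Gam g y A W)
   + metric g y (Gam g y A Z) (Gam g y B W)
   + metric g y Z (dGam g y A B W + Gam g y A (Gam g y B W)).
  rewrite (@dirder_near _ _ _ _ (fun z => metric g z (Gam g z B Z) W
     + metric g z (Gam g z B W) Z)); last first.
    near=> z; have Oz : O z by near: z; apply: near_open.
    by rewrite metric_compat // [metric g z Z _]metric_symO.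
  have dm (V : 'rV[R]_d -> 'rV[R]_d) U : (forall k, pderivable (fun z => V z 0 k) y) ->
      pderivable (fun z => metric g z (V z) U) y.
    move=> dV; under eq_fun do rewrite metricE.
    apply: pderivable_sum => j _; apply: pderivable_sum => k _.
    apply: pderivableM; last exact: pderivable_cst.
    by apply: pderivableM => //; apply: smooth_pderivable Oy.
  have dG B' Z' k : pderivable (fun z => Gam g z B' Z' 0 k) y by apply: pderivable_Gam.
  rewrite dirderD; [|exact: dm|exact: dm].
  rewrite (@dirder_metricl _ (fun z => Gam g z B Z)) //.
  rewrite (@dirder_metricl _ (fun z => Gam g z B W)) //.
  rewrite !metric_compat // -/(dGam g y A B Z) -/(dGam g y A B W).
  rewrite !metric_lin ![metric g y _ Z]metric_symO // ![metric g y (Gam g y B W) _]metric_symO //.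
  ring.
have /eqP := dirder_comm X Y openO Oy (smooth_metric Z W).
rewrite -subr_eq0 !H => /eqP E; rewrite -[RHS]E !riem_opE !metric_lin.
repeat match goal with
  | |- context [metric g y ?a ?b] => generalize (metric g y a b); intro
  end.
ring.
Unshelve. all: by end_near. Qed.

End LeviCivita.

(** * The curvature operator of a warped metric *)

Definition warping (R : realType) (I : set 'rV[R]_1) (phi : 'rV[R]_1 -> R) : Prop :=
  [/\ open I, smooth_on I phi & forall t, I t -> 0 < phi t].

Section Warped.
Variables (R : realType) (q : nat).
Variables (I : set 'rV[R]_1) (phi : 'rV[R]_1 -> R).
Variables (O : set 'rV[R]_q) (gam : 'rV[R]_q -> 'M[R]_q).
Variable G : 'rV[R]_(1 + q) -> 'M[R]_(1 + q).
Hypothesis hphi : warping I phi.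
Hypothesis hg : local_metric O gam.
Hypothesis G_block : forall y, I (lsubmx y) -> O (rsubmx y) ->
  G y = block_mx (-1)%:M 0 0 (phi (lsubmx y) *: gam (rsubmx y)).

Let openI : open I. Proof. by case: hphi. Qed.
Let smooth_phi : smooth_on I phi. Proof. by case: hphi. Qed.
Let phi_gt0 t : I t -> 0 < phi t. Proof. by case: hphi => _ _; apply. Qed.
Let openO : open O. Proof. by case: hg. Qed.
Let sym_gam y : O y -> (gam y)^T = gam y. Proof. by case: hg => _ _ + _; apply. Qed.
Let unit_gam y : O y -> gam y \in unitmx. Proof. by case: hg => _ _ _; apply. Qed.

Implicit Types (x y z : R) (X Y Z : 'rV[R]_q) (p : 'rV[R]_(1 + q)).

Definition pvec x X : 'rV[R]_(1 + q) := row_mx x%:M X.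

Lemma pvecE (V : 'rV[R]_(1 + q)) : V = pvec (lsubmx V 0 0) (rsubmx V).
Proof. by rewrite /pvec -mx11_scalar hsubmxK. Qed.

Lemma near_dom p : I (lsubmx p) -> O (rsubmx p) ->
  \near p, I (lsubmx p) /\ O (rsubmx p).
Proof.
move=> Ip Op.
have /nbhs_ballP[e1 /= e10 H1] := near_open openI Ip.
have /nbhs_ballP[e2 /= e20 H2] := near_open openO Op.
apply/nbhs_ballP; exists (Num.min e1 e2); first by rewrite /= lt_min e10.
move=> z [_ B]; split.
  by apply: H1; split=> // i j; rewrite !mxE; apply: le_ball (B _ _); rewrite ge_min lexx.
by apply: H2; split=> // i j; rewrite !mxE; apply: le_ball (B _ _); rewrite ge_min lexx orbT.
Qed.

Lemma metric_pvec p x y X Y : I (lsubmx p) -> O (rsubmx p) ->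
  metric G p (pvec x X) (pvec y Y)
  = - (x * y) + phi (lsubmx p) * metric gam (rsubmx p) X Y.
Proof.
move=> Ip Op; rewrite /metric G_block // /pvec mul_row_block tr_row_mx.
rewrite mul_row_col !mulmx0 addr0 add0r tr_scalar_mx -!scalar_mxM -scalemxAr -scalemxAl.
by rewrite !mxE eqxx mulr1n mulrN1 mulNr.
Qed.

Lemma lsub_delta (i : 'I_(1 + q)) : lsubmx (delta_mx 0 i : 'rV[R]_(1 + q))
  = if fintype.split i is inl j then delta_mx 0 j else 0.
Proof.
apply/rowP => k; rewrite !mxE eqxx /= -(inj_eq val_inj) /=.
case: splitP => [j|j] ij; rewrite !mxE ?eqxx /=.
  by rewrite ij.
by rewrite ij ltn_eqF // (leq_trans (ltn_ord k)) // leq_addr.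
Qed.

Lemma rsub_delta (i : 'I_(1 + q)) : rsubmx (delta_mx 0 i : 'rV[R]_(1 + q))
  = if fintype.split i is inr j then delta_mx 0 j else 0.
Proof.
apply/rowP => k; rewrite !mxE eqxx /= -(inj_eq val_inj) /=.
case: splitP => [j|j] ij; rewrite !mxE ?eqxx /=.
  by rewrite ij eqn_leq leqNgt (leq_trans (ltn_ord j)) // leq_addr.
by rewrite ij eqn_add2l.
Qed.

Lemma pderivable_lsub (f : 'rV[R]_1 -> R) p : pderivable f (lsubmx p) ->
  pderivable (fun v => f (lsubmx v)) p.
Proof.
move=> df i.
apply: (@derivable_comp_linear R 'rV[R]_(1 + q) 'rV[R]_1 lsubmx f).
rewrite /= lsub_delta; case: fintype.split => // j; exact: derivable0.
Qed.

Lemma pderivable_rsub (f : 'rV[R]_q -> R) p : pderivable f (rsubmx p) ->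
  pderivable (fun v => f (rsubmx v)) p.
Proof.
move=> df i.
apply: (@derivable_comp_linear R 'rV[R]_(1 + q) 'rV[R]_q rsubmx f).
rewrite /= rsub_delta; case: fintype.split => // j; exact: derivable0.
Qed.

Lemma dirder_lsub (f : 'rV[R]_1 -> R) p x X :
  dirder (pvec x X) (fun v => f (lsubmx v)) p = x * partial 0 f (lsubmx p).
Proof.
have E i : partial i (fun v => f (lsubmx v)) p
    = 'D_(lsubmx (delta_mx 0 i : 'rV[R]_(1 + q))) f (lsubmx p).
  exact: (@derive_comp_linear R 'rV[R]_(1 + q) 'rV[R]_1 lsubmx f).
rewrite /dirder big_split_ord big_ord1 /= [X in _ + X]big1; last first.
  by move=> j _; rewrite E lsub_delta (unsplitK (inr j)) derive0 mulr0.
by rewrite addr0 E lsub_delta row_mxEl mxE eqxx mulr1n (unsplitK (inl 0)).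
Qed.

Lemma dirder_rsub (f : 'rV[R]_q -> R) p x X :
  dirder (pvec x X) (fun v => f (rsubmx v)) p = dirder X f (rsubmx p).
Proof.
have E i : partial i (fun v => f (rsubmx v)) p
    = 'D_(rsubmx (delta_mx 0 i : 'rV[R]_(1 + q))) f (rsubmx p).
  exact: (@derive_comp_linear R 'rV[R]_(1 + q) 'rV[R]_q rsubmx f).
rewrite /dirder big_split_ord big_ord1 /= E rsub_delta (unsplitK (inl 0)).
rewrite derive0 mulr0 add0r; apply: eq_bigr => j _.
by rewrite E rsub_delta row_mxEr (unsplitK (inr j)).
Qed.

Definition phi1 := partial 0 phi.
Definition phi2 := partial 0 phi1.

(* If [phi = f ^+ 2] then [warp_w] is [f'^2] and [warp_u] is [f f'']. *)
Definition warp_w t := phi1 t ^+ 2 / (4 * phi t).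
Definition warp_u t := phi2 t / 2 - warp_w t.

Lemma smooth_phi1 : smooth_on I phi1.
Proof. exact: smooth_partial smooth_phi. Qed.

Lemma smooth_phi2 : smooth_on I phi2.
Proof. exact: smooth_partial smooth_phi1. Qed.

Section AtPoint.
Variable p : 'rV[R]_(1 + q).
Hypotheses (Ip : I (lsubmx p)) (Op : O (rsubmx p)).
Let t := lsubmx p.
Let s := rsubmx p.

Lemma phi_neq0 : phi t != 0.
Proof. by rewrite gt_eqF ?phi_gt0. Qed.

Lemma pderivable_phi : pderivable (fun v : 'rV[R]_(1 + q) => phi (lsubmx v)) p.
Proof. by apply: pderivable_lsub; apply: smooth_pderivable Ip. Qed.

Lemma pderivable_gam X Y :
  pderivable (fun v => metric gam (rsubmx v) X Y) p.
Proof.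
apply: (@pderivable_rsub (fun v => metric gam v X Y)).
apply: smooth_pderivable Op; exact: (smooth_metric hg).
Qed.

Lemma dirder_metric_pvec x y z X Y Z :
  dirder (pvec x X) (fun p => metric G p (pvec y Y) (pvec z Z)) p
  = x * phi1 t * metric gam s Y Z
    + phi t * dirder X (fun s => metric gam s Y Z) s.
Proof.
rewrite (@dirder_near _ _ _ _ (fun p => - (y * z) +
   phi (lsubmx p) * metric gam (rsubmx p) Y Z)); last first.
  near=> p'; have [] : I (lsubmx p') /\ O (rsubmx p').
    by near: p'; apply: near_dom.
  by move=> *; rewrite metric_pvec.
have dg := @pderivable_gam Y Z; have dp := pderivable_phi.
rewrite dirderD; [|exact: pderivable_cst|exact: pderivableM].
rewrite dirder_cst add0r dirderM // (@dirder_rsub (fun s => metric gam s Y Z)).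
by rewrite dirder_lsub addrC [X in X + _]mulrC.
Unshelve. all: by end_near. Qed.

Lemma G_sym : (G p)^T = G p.
Proof.
rewrite G_block // tr_block_mx !trmx0 linearZ /= sym_gam //.
by rewrite tr_scalar_mx.
Qed.

Lemma G_unit : G p \in unitmx.
Proof.
rewrite G_block // unitmxE det_lblock det_scalar expr1 unitrM unitrN1 /=.
by rewrite -unitmxE unitmxZ ?unitfE ?phi_neq0 // unit_gam.
Qed.

Lemma pderivable_G j k : pderivable (fun v => G v j k) p.
Proof.
pose V i : 'rV[R]_(1 + q) := delta_mx 0 i.
apply: (@pderivable_near _ _ (fun v => - (lsubmx (V j) 0 0 * lsubmx (V k) 0 0)
   + phi (lsubmx v) * metric gam (rsubmx v) (rsubmx (V j)) (rsubmx (V k)))).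
  near=> p'; have [] : I (lsubmx p') /\ O (rsubmx p').
    by near: p'; apply: near_dom.
  by move=> *; rewrite -metric_pvec // -!pvecE metric_delta2.
apply: pderivableD; first exact: pderivable_cst.
by apply: pderivableM; [exact: pderivable_phi|exact: pderivable_gam].
Unshelve. all: by end_near. Qed.

(** Both sides are paired with an arbitrary vector: the Koszul formula for [G] splits into
    derivatives of [phi] and the Koszul formula for the fiber. *)
Lemma Gam_pvec x y X Y : Gam G p (pvec x X) (pvec y Y)
  = pvec (phi1 t / 2 * metric gam s X Y)
         ((phi1 t / (2 * phi t)) *: (x *: Y + y *: X) + Gam gam s X Y).
Proof.
apply: (metric_inj G_unit) => V; rewrite (pvecE V).
set z := lsubmx V 0 0; set Z := rsubmx V.
rewrite koszul_at ?G_sym ?G_unit //; last exact: pderivable_G.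
rewrite !dirder_metric_pvec metric_pvec // !metric_lin -/t -/s.
rewrite (koszul hg) // (metric_symO hg Y Z) // (metric_symO hg X Z) //.
by have p0 := phi_neq0; field.
Qed.

End AtPoint.

Lemma dirder1 (f : 'rV[R]_1 -> R) t : dirder (delta_mx 0 0) f t = partial 0 f t.
Proof. by rewrite /dirder big_ord1 mxE eqxx mul1r. Qed.

Lemma pderivable_2phi t : I t -> pderivable (fun t => 2 * phi t) t.
Proof.
by move=> It; apply: pderivableM; [exact: pderivable_cst|exact: smooth_pderivable It].
Qed.

Lemma pderivable_ratio t : I t -> pderivable (fun t => phi1 t / (2 * phi t)) t.
Proof.
move=> It; apply: pderivableM; first exact: smooth_pderivable smooth_phi1 It.
apply: pderivableV (pderivable_2phi It).
by rewrite mulf_neq0 // gt_eqF ?phi_gt0.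
Qed.

Lemma partial_ratio t : I t ->
  partial 0 (fun t => phi1 t / (2 * phi t)) t
  = (phi2 t * phi t - phi1 t ^+ 2) / (2 * phi t ^+ 2).
Proof.
move=> It; have p0 : phi t != 0 by rewrite gt_eqF ?phi_gt0.
have d0 : pderivable phi t by exact: smooth_pderivable It.
have d1 : pderivable phi1 t by exact: smooth_pderivable smooth_phi1 It.
have n0 : 2 * phi t != 0 by rewrite mulf_neq0.
have d2 := pderivable_2phi It.
have d3 : pderivable (fun t => (2 * phi t)^-1) t by exact: pderivableV d2.
rewrite -dirder1 (dirderM _ d1 d3) (@dirderV _ _ _ (fun t => 2 * phi t)) // dirderZ // !dirder1.
by rewrite -/(phi1 t) -/(phi2 t); field.
Qed.

Lemma warp_wE t : I t -> warp_w t = phi1 t * (phi1 t / (2 * phi t)) * 2^-1.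
Proof.
by move=> It; have p0 : phi t != 0; [rewrite gt_eqF ?phi_gt0|rewrite /warp_w; field].
Qed.

Lemma pderivable_warp_w t : I t -> pderivable warp_w t.
Proof.
move=> It; apply: (@pderivable_near _ _
  (fun t => phi1 t * (phi1 t / (2 * phi t)) * 2^-1)).
  by near=> z; rewrite warp_wE //; near: z; exact: near_open.
apply: pderivableM; last exact: pderivable_cst.
by apply: pderivableM; [exact: smooth_pderivable smooth_phi1 It|exact: pderivable_ratio].
Unshelve. all: by end_near. Qed.

(** Read in both directions below: where [u = 0] it makes [w] constant, and where [u <> 0] a
    constant [w] forces [phi' = 0]. *)
Lemma partial_warp_w t : I t -> partial 0 warp_w t = phi1 t * warp_u t / phi t.
Proof.
move=> It; have p0 : phi t != 0 by rewrite gt_eqF ?phi_gt0.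
have d1 : pderivable phi1 t by exact: smooth_pderivable smooth_phi1 It.
have d2 := pderivable_ratio It.
rewrite -dirder1 (@dirder_near _ _ _ _
  (fun t => phi1 t * (phi1 t / (2 * phi t)) * 2^-1)); last first.
  by near=> z; rewrite warp_wE //; near: z; exact: near_open.
rewrite dirderZr; last exact: pderivableM.
rewrite (dirderM _ d1 d2) !dirder1 partial_ratio // -/(phi2 t).
by rewrite /warp_u /warp_w; field.
Unshelve. all: by end_near. Qed.

Section Curvature.
Variable p : 'rV[R]_(1 + q).
Hypotheses (Ip : I (lsubmx p)) (Op : O (rsubmx p)).
Let t := lsubmx p.
Let s := rsubmx p.

Lemma dGam_pvec x y z X Y Z : dGam G p (pvec x X) (pvec y Y) (pvec z Z)
  = pvec (x * phi2 t / 2 * metric gam s Y Z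
          + phi1 t / 2 * dirder X (fun s => metric gam s Y Z) s)
         ((x * (phi2 t * phi t - phi1 t ^+ 2) / (2 * phi t ^+ 2)) *: (y *: Z + z *: Y)
          + dGam gam s X Y Z).
Proof.
have d1 : pderivable (fun v : 'rV[R]_(1 + q) => phi1 (lsubmx v)) p.
  by apply: pderivable_lsub; apply: smooth_pderivable smooth_phi1 Ip.
have d12 : pderivable (fun v : 'rV[R]_(1 + q) =>
    phi1 (lsubmx v) / (2 * phi (lsubmx v))) p.
  exact: (@pderivable_lsub (fun t => phi1 t / (2 * phi t))) (pderivable_ratio Ip).
have d1c : pderivable (fun v : 'rV[R]_(1 + q) => phi1 (lsubmx v) / 2) p.
  by apply: pderivableM d1 _; exact: pderivable_cst.
have d12c c : pderivable (fun v : 'rV[R]_(1 + q) =>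
    phi1 (lsubmx v) / (2 * phi (lsubmx v)) * c) p.
  by apply: pderivableM d12 _; exact: pderivable_cst.
have near_Gam k : \near p, Gam G p (pvec y Y) (pvec z Z) 0 k
    = pvec (phi1 (lsubmx p) / 2 * metric gam (rsubmx p) Y Z)
         ((phi1 (lsubmx p) / (2 * phi (lsubmx p))) *: (y *: Z + z *: Y)
           + Gam gam (rsubmx p) Y Z) 0 k.
  near=> p'; have [] : I (lsubmx p') /\ O (rsubmx p').
    by near: p'; apply: near_dom.
  by move=> *; rewrite Gam_pvec.
apply/rowP => k; rewrite mxE (dirder_near _ (near_Gam k)) /pvec.
case: (split_ordP k) => j ->.
  rewrite row_mxEl mxE (ord1 j) eqxx mulr1n.
  under eq_fun do rewrite row_mxEl mxE eqxx mulr1n.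
  have dm := @pderivable_gam p Op Y Z.
  rewrite dirderM; [|exact: d1c|exact: dm].
  rewrite (@dirder_rsub (fun s => metric gam s Y Z)) (dirderZr _ _ d1).
  rewrite dirder_lsub -/t -/s -/(phi2 t).
  by rewrite addrC; congr (_ + _); rewrite mulrC.
rewrite row_mxEr.
under eq_fun do rewrite row_mxEr mxE [X in X + _]mxE.
have dG : pderivable (fun s => Gam gam s Y Z 0 j) (rsubmx p).
  exact: (pderivable_Gam hg).
have dG' : pderivable (fun v : 'rV[R]_(1 + q) => Gam gam (rsubmx v) Y Z 0 j) p.
  exact: (@pderivable_rsub (fun s => Gam gam s Y Z 0 j)).
rewrite dirderD; [|exact: d12c|exact: dG'].
rewrite (@dirder_rsub (fun s => Gam gam s Y Z 0 j)) (dirderZr _ _ d12).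
rewrite (@dirder_lsub (fun t => phi1 t / (2 * phi t))) partial_ratio //.
by rewrite !mxE -/t -/s mulrA.
Unshelve. all: by end_near. Qed.

(** The term in [warp_w] is the Gauss correction from the second fundamental form of the slices of
    constant time; the curvature of every plane through the time direction is governed by
    [warp_u]. *)
Lemma riem_op_pvec x y z X Y Z : riem_op G p (pvec x X) (pvec y Y) (pvec z Z)
  = pvec (warp_u t * (x * metric gam s Y Z - y * metric gam s X Z))
         (riem_op gam s X Y Z
          + warp_w t *: (metric gam s Y Z *: X - metric gam s X Z *: Y)
          + (warp_u t / phi t * z) *: (x *: Y - y *: X)).
Proof.
have p0 : phi t != 0 by exact: phi_neq0.
rewrite riem_opE !dGam_pvec !Gam_pvec // -/t -/s !metric_lin.
rewrite !(metric_compat hg) //.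
rewrite !(GamDr, GamZr) riem_opE.
rewrite (GamC hg Y X) //.
rewrite (metric_symO hg Y X) //.
rewrite /pvec /warp_u /warp_w; move: (phi t) (phi1 t) (phi2 t) p0 => f f1 f2 p0.
repeat match goal with
  | |- context [dGam gam s ?a ?b ?c] => generalize (dGam gam s a b c); intro
  | |- context [Gam gam s ?a ?b] => generalize (Gam gam s a b); intro
  | |- context [metric gam s ?a ?b] => generalize (metric gam s a b); intro
  end.
apply/rowP => k; rewrite !mxE.
case: splitP => j _; rewrite !mxE; last by field.
by rewrite (ord1 j) eqxx !mulr1n; field.
Qed.

End Curvature.

End Warped.

(** * Ricci tensor *)

Section Trace.
Variables (R : realType) (d : nat).
Implicit Types (f : 'rV[R]_d -> 'rV[R]_d) (V : 'rV[R]_d).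

(** Defined for arbitrary functions: only the diagonal entries are read, so the trace rules below
    need no linearity. *)
Definition fun_tr f : R := \tr (lin1_mx f).

Lemma fun_trE f : fun_tr f = \sum_i f (delta_mx 0 i) 0 i.
Proof. by apply: eq_bigr => i _; rewrite mxE. Qed.

Lemma fun_trD f f' : fun_tr (fun X => f X + f' X) = fun_tr f + fun_tr f'.
Proof.
by rewrite !fun_trE -big_split; apply: eq_bigr => i _; rewrite !mxE.
Qed.

Lemma fun_trZ a f : fun_tr (fun X => a *: f X) = a * fun_tr f.
Proof.
by rewrite !fun_trE mulr_sumr; apply: eq_bigr => i _; rewrite !mxE.
Qed.

Lemma fun_trN f : fun_tr (fun X => - f X) = - fun_tr f.
Proof.
by rewrite !fun_trE -sumrN; apply: eq_bigr => i _; rewrite !mxE.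
Qed.

Lemma fun_tr_id : fun_tr id = d%:R.
Proof.
rewrite fun_trE (eq_bigr (fun=> 1)); first by rewrite sumr_const card_ord.
by move=> i _; rewrite mxE !eqxx.
Qed.

Lemma fun_tr_metricr g y V U :
  fun_tr (fun X => metric g y U X *: V) = metric g y U V.
Proof.
rewrite fun_trE /metric mxE; apply: eq_bigr => i _.
by rewrite -/(metric g y U _) metric_delta mxE [V^T _ _]mxE.
Qed.

End Trace.

(* The traceless Ricci operator; locked, since rewriting with [metricDl] would
   otherwise unfold it into a sum. *)
HB.lock Definition ricci0_op (R : realType) (d : nat) (g : 'rV[R]_d -> 'M[R]_d)
  (y X : 'rV[R]_d) : 'rV[R]_d :=
  ricci_op g y X - (scalar_curv g y / d%:R) *: X.

Section FiberTraces.
Variables (R : realType) (d : nat) (g : 'rV[R]_d -> 'M[R]_d) (O : set 'rV[R]_d).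
Hypothesis hg : local_metric O g.

Let sym_g y : O y -> (g y)^T = g y. Proof. by case: hg => _ _ + _; apply. Qed.
Let unit_g y : O y -> g y \in unitmx. Proof. by case: hg => _ _ _; apply. Qed.

Variable y : 'rV[R]_d.
Hypothesis Oy : O y.
Implicit Types (X Y Z W V : 'rV[R]_d).

Lemma ricciE X Y : ricci g y X Y = fun_tr (fun Z => riem_op g y Z X Y).
Proof. by []. Qed.

Lemma riem_trm X Z : fun_tr (fun Y => riem_op g y X Y Z) = - ricci g y X Z.
Proof.
by rewrite ricciE -fun_trN; congr fun_tr; apply/funext => Y; rewrite riem_opC.
Qed.

Lemma ricciDr X Y Z : ricci g y X (Y + Z) = ricci g y X Y + ricci g y X Z.
Proof.
rewrite !ricciE -fun_trD; congr fun_tr; apply/funext => V.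
exact: (riem_opDr hg).
Qed.

Lemma ricciZr a X Y : ricci g y X (a *: Y) = a * ricci g y X Y.
Proof.
rewrite !ricciE -fun_trZ; congr fun_tr; apply/funext => V.
exact: (riem_opZr hg).
Qed.

Lemma ricciDl X Y Z : ricci g y (Y + Z) X = ricci g y Y X + ricci g y Z X.
Proof.
rewrite !ricciE -fun_trD; congr fun_tr; apply/funext => V.
exact: (riem_opDm hg).
Qed.

Lemma ricciZl a X Y : ricci g y (a *: Y) X = a * ricci g y Y X.
Proof.
rewrite !ricciE -fun_trZ; congr fun_tr; apply/funext => V.
exact: (riem_opZm hg).
Qed.

Lemma row_sum (V : 'rV[R]_d) : V = \sum_i V 0 i *: delta_mx 0 i.
Proof. exact: row_sum_delta. Qed.

Lemma ricci_op_metric X Y : metric g y (ricci_op g y X) Y = ricci g y X Y.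
Proof.
have ->: ricci g y X Y = \sum_i Y 0 i * ricci g y X (delta_mx 0 i).
  rewrite {1}[Y]row_sum; elim/big_rec2: _ => [|i a b _ IH].
    by have := ricciZr 0 X 0; rewrite scale0r mul0r.
  by rewrite ricciDr ricciZr IH.
rewrite /metric /ricci_op mulmxKV ?unit_g // mxE; apply: eq_bigr => i _.
by rewrite !mxE mulrC.
Qed.

(** In matrix form skewness says [M g = - g M^T], so [M] is conjugate to [- M^T] and its trace
    equals its own negative. *)
Lemma fun_tr_skew (T : 'rV[R]_d -> 'rV[R]_d) : linear T ->
  (forall X Y, metric g y (T X) Y + metric g y X (T Y) = 0) -> fun_tr T = 0.
Proof.
move=> Tlin skew.
pose M := lin1_mx T.
have E : M *m g y = - (g y *m M^T).
  apply/matrixP => i j; rewrite [RHS]mxE; apply/eqP; rewrite -addr_eq0.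
  apply/eqP.
  rewrite -[RHS](skew (delta_mx 0 i) (delta_mx 0 j)); congr (_ + _).
    rewrite metric_delta mxE [RHS]mxE; apply: eq_bigr => k _.
    by rewrite mxE.
  rewrite (metric_symO hg) // metric_delta !mxE; apply: eq_bigr => k _.
  by rewrite !mxE mulrC -[g y i k](metric_delta2 g) (metric_symO hg) // metric_delta2.
have : \tr M = - \tr M.
  rewrite -{1}[M](mulmxK (unit_g Oy)) E mulNmx linearN /= mxtrace_mulC mulmxA.
  by rewrite mulVmx ?unit_g // mul1mx mxtrace_tr.
rewrite /fun_tr -/M => /eqP; rewrite -addr_eq0 -mulr2n mulrn_eq0 /=.
by move/eqP.
Qed.

Lemma riem_tr0 X Y : fun_tr (fun Z => riem_op g y X Y Z) = 0.
Proof.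
apply: fun_tr_skew => [a U V|U V]; last exact: (riem_op_skew hg).
rewrite (riem_opDr hg) //.
by rewrite (riem_opZr hg).
Qed.

(** Contracting the Bianchi identity, the difference of the two sides is up to sign the trace of
    [riem_op g y X Y], which is skew. *)
Lemma ricci_sym X Y : ricci g y X Y = ricci g y Y X.
Proof.
rewrite !ricciE; apply/eqP; rewrite -subr_eq0; apply/eqP.
rewrite -[RHS]oppr0 -(riem_tr0 X Y) -!fun_trN -fun_trD; congr fun_tr.
apply/funext => Z; apply/eqP; rewrite -subr_eq0 opprK.
have /eqP := bianchi hg Z X Y Oy.
by rewrite (riem_opC g y Z Y) addrAC.
Qed.

Local Notation ricci0_op := (ricci0_op g y).

Lemma ricci_opE X : ricci_op g y X = ricci0_op X + (scalar_curv g y / d%:R) *: X.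
Proof. by rewrite unlock subrK. Qed.

Lemma ricci_ricci0 X Y : ricci g y X Y
  = metric g y (ricci0_op X) Y + scalar_curv g y / d%:R * metric g y X Y.
Proof. by rewrite -ricci_op_metric ricci_opE !metric_lin. Qed.

Lemma ricci_opD X Y : ricci_op g y (X + Y) = ricci_op g y X + ricci_op g y Y.
Proof.
apply: (metric_inj (unit_g Oy)) => Z.
by rewrite metric_lin !ricci_op_metric ricciDl.
Qed.

Lemma ricci_opZ a X : ricci_op g y (a *: X) = a *: ricci_op g y X.
Proof.
apply: (metric_inj (unit_g Oy)) => Z.
by rewrite metric_lin !ricci_op_metric ricciZl.
Qed.

Lemma ricci0_opD X Y : ricci0_op (X + Y) = ricci0_op X + ricci0_op Y.
Proof. by rewrite unlock ricci_opD scalerDr opprD addrACA. Qed.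

Lemma ricci0_opZ a X : ricci0_op (a *: X) = a *: ricci0_op X.
Proof. by rewrite unlock ricci_opZ scalerBr !scalerA mulrC. Qed.

Lemma ricci0_op_sym X Y :
  metric g y (ricci0_op X) Y = metric g y X (ricci0_op Y).
Proof.
rewrite unlock !metric_lin ricci_op_metric; congr (_ - _).
by rewrite (metric_symO hg X) // ricci_op_metric ricci_sym.
Qed.

Lemma ricci0_op_tr : (0 < d)%N -> fun_tr ricci0_op = 0.
Proof.
move=> d0; rewrite unlock fun_trD fun_trN fun_trZ.
rewrite fun_tr_id -/(scalar_curv g y) divfK ?subrr //.
by rewrite pnatr_eq0 -lt0n.
Qed.

(** Consequently a nonzero traceless Ricci operator is linearly independent of the identity, and
    coefficients in a relation between the two can be compared. *)
Lemma ricci0_op_scalar a : (0 < d)%N -> (forall X, ricci0_op X = a *: X) ->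
  forall X, ricci0_op X = 0.
Proof.
move=> d0 E X; have := ricci0_op_tr d0.
rewrite (_ : ricci0_op = fun Y => a *: Y); last exact/funext.
rewrite fun_trZ fun_tr_id => /eqP; rewrite mulf_eq0 pnatr_eq0 gtn_eqF // orbF.
by move/eqP->; rewrite scale0r.
Qed.

Lemma einstein_ricci0 : einstein_at g y <-> forall X, ricci0_op X = 0.
Proof.
split=> [E X|E X Y].
  apply: (metric_inj (unit_g Oy)) => Y; rewrite metric_lin.
  by have := E X Y; rewrite ricci_ricci0 => /(canRL (addrK _)); rewrite subrr.
by rewrite ricci_ricci0 E metric_lin add0r.
Qed.

End FiberTraces.

(** * The curvature condition on a warped product *)

(* [- R . S0] and [Q(g, S0)] for the traceless Ricci tensor [S0]. *)
Definition riem_dot_ricci0 (R : realType) (d : nat) (g : 'rV[R]_d -> 'M[R]_d)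
    (y X Y X2 X3 : 'rV[R]_d) : R :=
  let r := ricci0_op g y in
  metric g y (r (riem_op g y X Y X2)) X3 + metric g y (r X2) (riem_op g y X Y X3).

Definition Q_ricci0 (R : realType) (d : nat) (g : 'rV[R]_d -> 'M[R]_d)
    (y X Y X2 X3 : 'rV[R]_d) : R :=
  let h := metric g y in let r := ricci0_op g y in
  h (r Y) X2 * h X X3 - h (r X) X2 * h Y X3
  + h (r Y) X3 * h X X2 - h (r X) X3 * h Y X2.

Section WarpedCurvature.
Variables (R : realType) (q : nat).
Variables (I : set 'rV[R]_1) (phi : 'rV[R]_1 -> R).
Variables (O : set 'rV[R]_q) (gam : 'rV[R]_q -> 'M[R]_q).
Variable G : 'rV[R]_(1 + q) -> 'M[R]_(1 + q).
Hypothesis q_gt0 : (0 < q)%N.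
Hypothesis hphi : warping I phi.
Hypothesis hg : local_metric O gam.
Hypothesis G_block : forall y, I (lsubmx y) -> O (rsubmx y) ->
  G y = block_mx (-1)%:M 0 0 (phi (lsubmx y) *: gam (rsubmx y)).
Variable p : 'rV[R]_(1 + q).
Hypotheses (Ip : I (lsubmx p)) (Op : O (rsubmx p)).
Implicit Types (x y z : R) (X Y Z V : 'rV[R]_q).

Let t := lsubmx p.
Let s := rsubmx p.
Let f := phi t.
Let u := warp_u phi t.
Let w := warp_w phi t.
Let h := metric gam s.
Let r := ricci0_op gam s.
Let Rt := riem_op gam s.
(** On fiber vectors the Ricci tensor of the warped metric is [h (r X) Y + (chat + u) * h X Y], see
    [ricci_pvec]. *)
Let chat := scalar_curv gam s / q%:R + (q%:R - 1) * w.

Let f_neq0 : f != 0.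
Proof. exact: (phi_neq0 hphi Ip). Qed.

Let q_neq0 : q%:R != 0 :> R.
Proof. by rewrite pnatr_eq0 -lt0n. Qed.

Let unit_s : gam s \in unitmx.
Proof. by case: hg => _ _ _; apply. Qed.

Let hC X Y : h X Y = h Y X.
Proof. exact: (metric_symO hg). Qed.

Let hDl X Y Z : h (X + Y) Z = h X Z + h Y Z. Proof. exact: metricDl. Qed.
Let hZl a X Y : h (a *: X) Y = a * h X Y. Proof. exact: metricZl. Qed.
Let hNl X Y : h (- X) Y = - h X Y. Proof. exact: metricNl. Qed.
Let h0l X : h 0 X = 0. Proof. exact: metric0l. Qed.
Let hDr X Y Z : h Z (X + Y) = h Z X + h Z Y. Proof. exact: metricDr. Qed.
Let hZr a X Y : h Y (a *: X) = a * h Y X. Proof. exact: metricZr. Qed.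
Let hNr X Y : h Y (- X) = - h Y X. Proof. exact: metricNr. Qed.
Let h0r X : h X 0 = 0. Proof. exact: metric0r. Qed.
Let hlin := (hDl, hZl, hNl, h0l, hDr, hZr, hNr, h0r).

Lemma pvecD x y X Y : pvec x X + pvec y Y = pvec (x + y) (X + Y).
Proof. by rewrite /pvec add_row_mx raddfD. Qed.

Lemma pvecZ a x X : a *: pvec x X = pvec (a * x) (a *: X).
Proof. by rewrite /pvec scale_row_mx scale_scalar_mx. Qed.

Lemma pvecN x X : - pvec x X = pvec (- x) (- X).
Proof. by rewrite -scaleN1r pvecZ mulN1r scaleN1r. Qed.

Let pvec_lin := (pvecN, pvecZ, pvecD).

Let metricG x y X Y : metric G p (pvec x X) (pvec y Y) = - (x * y) + f * h X Y.
Proof. exact: (metric_pvec G_block). Qed.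

Let riemG x y z X Y Z : riem_op G p (pvec x X) (pvec y Y) (pvec z Z)
  = pvec (u * (x * h Y Z - y * h X Z))
         (Rt X Y Z + w *: (h Y Z *: X - h X Z *: Y) + (u / f * z) *: (x *: Y - y *: X)).
Proof. exact: (riem_op_pvec hphi hg G_block). Qed.

Lemma fun_tr_pvec (T : 'rV[R]_(1 + q) -> 'rV[R]_(1 + q)) :
  fun_tr T = lsubmx (T (pvec 1 0)) 0 0 + fun_tr (fun V => rsubmx (T (pvec 0 V))).
Proof.
rewrite !fun_trE big_split_ord big_ord1 /=; congr (_ + _).
  rewrite mxE; congr (T _ _ _); rewrite [LHS]pvecE lsub_delta rsub_delta.
  by rewrite (unsplitK (inl 0)) mxE !eqxx.
apply: eq_bigr => i _; rewrite mxE; congr (T _ _ _).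
rewrite [LHS]pvecE lsub_delta rsub_delta (unsplitK (inr i)).
by rewrite mxE.
Qed.

Lemma ricci_pvec x z X Z : ricci G p (pvec x X) (pvec z Z)
  = h (r X) Z + (chat + u) * h X Z - q%:R * (u / f) * x * z.
Proof.
rewrite ricciE fun_tr_pvec riemG /pvec row_mxKl mxE eqxx mulr1n.
rewrite -/(pvec x X) -/(pvec z Z).
transitivity (u * h X Z + fun_tr (fun V => Rt V X Z +
    (w *: (h X Z *: V + - (h Z V *: X)) + (- (u / f * z * x)) *: V))).
  congr (_ + _); first by rewrite hlin; ring.
  congr fun_tr; apply/funext => V.
  rewrite -/(pvec 0 V) riemG row_mxKr -addrA scale0r sub0r scalerN scalerA.
  by rewrite scaleNr (hC V).
have -> : forall a b c (T : 'rV[R]_q -> 'rV[R]_q), fun_tr (fun V => T V +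
    (a *: (b *: V + - (h Z V *: X)) + c *: V))
  = fun_tr T + (a * (b * q%:R - fun_tr (fun V => h Z V *: X)) + c * q%:R).
  move=> a b c T; rewrite fun_trD (fun_trD (fun V => a *: _)) !fun_trZ fun_trD.
  by rewrite fun_trZ fun_trN fun_tr_id.
rewrite (fun_tr_metricr gam s) (_ : fun_tr (fun V => _ V X Z) = ricci gam s X Z) //.
rewrite (ricci_ricci0 hg Op) -/s -/r -/(h _ _) -/(h _ _) -/(h _ _) (hC Z).
by rewrite /chat; field; rewrite ?q_neq0 ?f_neq0.
Qed.

Lemma ricci_op_pvec x X : ricci_op G p (pvec x X)
  = pvec (q%:R * (u / f) * x) (f^-1 *: (r X + (chat + u) *: X)).
Proof.
have uG := G_unit hphi hg G_block Ip Op.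
rewrite /ricci_op; apply: (can_inj (mulmxK uG)); rewrite mulmxKV //.
apply/rowP => j; rewrite mxE -metric_delta [delta_mx 0 j]pvecE.
by rewrite ricci_pvec metricG !hlin; field; rewrite ?q_neq0 ?f_neq0.
Qed.

Lemma scalar_curv_warped :
  scalar_curv G p = q%:R * (u / f) + f^-1 * (q%:R * (chat + u)).
Proof.
rewrite /scalar_curv -/(fun_tr _) fun_tr_pvec ricci_op_pvec.
rewrite /pvec row_mxKl mxE eqxx mulr1n mulr1; congr (_ + _).
under [fun V => _]eq_fun do rewrite -/(pvec _ _) ricci_op_pvec row_mxKr.
by rewrite fun_trZ fun_trD fun_trZ fun_tr_id (ricci0_op_tr _ _ q_gt0) add0r [_ * q%:R]mulrC.
Qed.

(* The Weyl operator is [riem_op - (n - 2)^-1 *: weyl_corr]. *)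
Definition weyl_corr (X Y Z : 'rV[R]_(1 + q)) : 'rV[R]_(1 + q) :=
  wedge (metric G p) X (ricci_op G p Y) Z
  + wedge (metric G p) (ricci_op G p X) Y Z
  - (scalar_curv G p / q%:R) *: wedge (metric G p) X Y Z.

Definition corr_tensor : tensor4 R (1 + q) :=
  fun X1 X2 X3 X4 : 'rV[R]_(1 + q) => metric G p (weyl_corr X1 X2 X3) X4.

(** By [ricci_op_pvec], [lambda] is the eigenvalue of the Ricci operator on the time direction, and
    [A'] is [f] times its restriction to the fiber. *)
Let lambda := q%:R * (u / f).
Let A' X := r X + (chat + u) *: X.

Lemma weyl_corr_pvec x y z X Y Z :
  let a := - (lambda * y * z) + h (A' Y) Z in
  let b := - (x * z) + f * h X Z in
  let c := - (y * z) + f * h Y Z in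
  let d := - (lambda * x * z) + h (A' X) Z in
  let k := u / f + f^-1 * (chat + u) in
  weyl_corr (pvec x X) (pvec y Y) (pvec z Z)
  = pvec (a * x - b * (lambda * y) + c * (lambda * x) - d * y - k * (c * x - b * y))
         (a *: X - (b / f) *: A' Y + (c / f) *: A' X - d *: Y - k *: (c *: X - b *: Y)).
Proof.
move=> a b c d k.
rewrite /weyl_corr /wedge !ricci_op_pvec -/lambda -!/(A' _) !metricG.
have -> : scalar_curv G p / q%:R = k by rewrite scalar_curv_warped /k; field; rewrite f_neq0.
have E V : f * h (f^-1 *: A' V) Z = h (A' V) Z.
  by rewrite hlin mulVKf.
rewrite !E -/a -/b -/c -/d !pvec_lin; congr pvec; first by ring.
by rewrite !scalerA !addrA.
Qed.

Let K X1 X2 X3 X4 := h (Rt X1 X2 X3) X4.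

Let KDl X Y X2 X3 X4 : K (X + Y) X2 X3 X4 = K X X2 X3 X4 + K Y X2 X3 X4.
Proof. by rewrite /K /Rt (riem_opDl hg) // hlin. Qed.

Let KZl a X X2 X3 X4 : K (a *: X) X2 X3 X4 = a * K X X2 X3 X4.
Proof. by rewrite /K /Rt (riem_opZl hg) // hlin. Qed.

Let KDm X Y X1 X3 X4 : K X1 (X + Y) X3 X4 = K X1 X X3 X4 + K X1 Y X3 X4.
Proof. by rewrite /K /Rt (riem_opDm hg) // hlin. Qed.

Let KZm a X X1 X3 X4 : K X1 (a *: X) X3 X4 = a * K X1 X X3 X4.
Proof. by rewrite /K /Rt (riem_opZm hg) // hlin. Qed.

Let KDr X Y X1 X2 X4 : K X1 X2 (X + Y) X4 = K X1 X2 X X4 + K X1 X2 Y X4.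
Proof. by rewrite /K /Rt (riem_opDr hg) // hlin. Qed.

Let KZr a X X1 X2 X4 : K X1 X2 (a *: X) X4 = a * K X1 X2 X X4.
Proof. by rewrite /K /Rt (riem_opZr hg) // hlin. Qed.

Let KD4 X Y X1 X2 X3 : K X1 X2 X3 (X + Y) = K X1 X2 X3 X + K X1 X2 X3 Y.
Proof. by rewrite /K hlin. Qed.

Let KZ4 a X X1 X2 X3 : K X1 X2 X3 (a *: X) = a * K X1 X2 X3 X.
Proof. by rewrite /K hlin. Qed.

Let K0l X2 X3 X4 : K 0 X2 X3 X4 = 0.
Proof. by have := KZl 0 0 X2 X3 X4; rewrite scale0r mul0r. Qed.

Let K0m X1 X3 X4 : K X1 0 X3 X4 = 0.
Proof. by have := KZm 0 0 X1 X3 X4; rewrite scale0r mul0r. Qed.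

Let K0r X1 X2 X4 : K X1 X2 0 X4 = 0.
Proof. by have := KZr 0 0 X1 X2 X4; rewrite scale0r mul0r. Qed.

Let K04 X1 X2 X3 : K X1 X2 X3 0 = 0.
Proof. by have := KZ4 0 0 X1 X2 X3; rewrite scale0r mul0r. Qed.

Let KNl X X2 X3 X4 : K (- X) X2 X3 X4 = - K X X2 X3 X4.
Proof. by rewrite -scaleN1r KZl mulN1r. Qed.

Let KNm X X1 X3 X4 : K X1 (- X) X3 X4 = - K X1 X X3 X4.
Proof. by rewrite -scaleN1r KZm mulN1r. Qed.

Let KNr X X1 X2 X4 : K X1 X2 (- X) X4 = - K X1 X2 X X4.
Proof. by rewrite -scaleN1r KZr mulN1r. Qed.

Let KN4 X X1 X2 X3 : K X1 X2 X3 (- X) = - K X1 X2 X3 X.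
Proof. by rewrite -scaleN1r KZ4 mulN1r. Qed.

Let Klin := (KDl, KZl, KNl, K0l, KDm, KZm, KNm, K0m, KDr, KZr, KNr, K0r,
  KD4, KZ4, KN4, K04).

(* [ring] compares atoms up to conversion, which would unfold the curvature. *)
Ltac atoms := repeat match goal with
  | |- context [K ?a ?b ?c ?d] => generalize (K a b c d); intro
  | |- context [h ?a ?b] => generalize (h a b); intro
  end.

Lemma tensor_R_pvec x1 x2 x3 x4 X1 X2 X3 X4 :
  tensor_R G p (pvec x1 X1) (pvec x2 X2) (pvec x3 X3) (pvec x4 X4)
  = - (u * (x1 * h X2 X3 - x2 * h X1 X3) * x4)
    + f * (K X1 X2 X3 X4 + w * (h X2 X3 * h X1 X4 - h X1 X3 * h X2 X4))
    + u * x3 * (x1 * h X2 X4 - x2 * h X1 X4).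
Proof. by rewrite /tensor_R riemG metricG /K !hlin; field. Qed.

Lemma pvec_surj (V : 'rV[R]_(1 + q)) : exists x X, V = pvec x X.
Proof. by exists (lsubmx V 0 0), (rsubmx V); apply: pvecE. Qed.

(** Linearity, here and in the three lemmas below, in exactly the shape in which the Weyl operator
    enters each slot. *)
Lemma tensor_R_sub1 a (U V X2 X3 X4 : 'rV[R]_(1 + q)) :
  tensor_R G p (U - a *: V) X2 X3 X4
  = tensor_R G p U X2 X3 X4 - a * tensor_R G p V X2 X3 X4.
Proof.
have [? [? ->]] := pvec_surj U; have [? [? ->]] := pvec_surj V.
have [? [? ->]] := pvec_surj X2; have [? [? ->]] := pvec_surj X3.
have [? [? ->]] := pvec_surj X4.
by rewrite !pvec_lin !tensor_R_pvec !Klin !hlin; atoms; ring.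
Qed.

Lemma tensor_R_sub2 a (U V X1 X3 X4 : 'rV[R]_(1 + q)) :
  tensor_R G p X1 (U - a *: V) X3 X4
  = tensor_R G p X1 U X3 X4 - a * tensor_R G p X1 V X3 X4.
Proof.
have [? [? ->]] := pvec_surj U; have [? [? ->]] := pvec_surj V.
have [? [? ->]] := pvec_surj X1; have [? [? ->]] := pvec_surj X3.
have [? [? ->]] := pvec_surj X4.
by rewrite !pvec_lin !tensor_R_pvec !Klin !hlin; atoms; ring.
Qed.

Lemma tensor_R_sub3 a (U V X1 X2 X4 : 'rV[R]_(1 + q)) :
  tensor_R G p X1 X2 (U - a *: V) X4
  = tensor_R G p X1 X2 U X4 - a * tensor_R G p X1 X2 V X4.
Proof.
have [? [? ->]] := pvec_surj U; have [? [? ->]] := pvec_surj V.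
have [? [? ->]] := pvec_surj X1; have [? [? ->]] := pvec_surj X2.
have [? [? ->]] := pvec_surj X4.
by rewrite !pvec_lin !tensor_R_pvec !Klin !hlin; atoms; ring.
Qed.

Lemma tensor_R_sub4 a (U V X1 X2 X3 : 'rV[R]_(1 + q)) :
  tensor_R G p X1 X2 X3 (U - a *: V)
  = tensor_R G p X1 X2 X3 U - a * tensor_R G p X1 X2 X3 V.
Proof. by rewrite /tensor_R metricDr metricNr metricZr. Qed.

(** With [E] for the correction, this is [E . R - R . E], which remains of [R . C - C . R] after the
    two copies of [R . R] cancel. *)
Definition comm_tensor (X1 X2 X3 X4 X Y : 'rV[R]_(1 + q)) :=
  op_dot weyl_corr (tensor_R G p) X1 X2 X3 X4 X Y
  - op_dot (riem_op G p) corr_tensor X1 X2 X3 X4 X Y.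

Lemma R_dot_C_sub_C_dot_R (X1 X2 X3 X4 X Y : 'rV[R]_(1 + q)) :
  R_dot_C G p X1 X2 X3 X4 X Y - C_dot_R G p X1 X2 X3 X4 X Y
  = ((1 + q)%:R - 2)^-1 * comm_tensor X1 X2 X3 X4 X Y.
Proof.
set c := (_ - 2)^-1.
have wE (U V W : 'rV[R]_(1 + q)) : weyl_op G p U V W = riem_op G p U V W - c *: weyl_corr U V W.
  have qE : (1 + q)%:R - 1 = q%:R :> R by rewrite natrD addrC addKr.
  by rewrite /weyl_op qE.
have CE (U1 U2 U3 U4 : 'rV[R]_(1 + q)) : tensor_C G p U1 U2 U3 U4
    = tensor_R G p U1 U2 U3 U4 - c * corr_tensor U1 U2 U3 U4.
  by rewrite /tensor_C wE metricDl metricNl metricZl.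
rewrite /R_dot_C /C_dot_R /comm_tensor /op_dot !CE !wE.
rewrite tensor_R_sub1 tensor_R_sub2 tensor_R_sub3 tensor_R_sub4.
repeat match goal with
  | |- context [tensor_R G p ?a ?b ?c ?d] => generalize (tensor_R G p a b c d); intro
  | |- context [corr_tensor ?a ?b ?c ?d] => generalize (corr_tensor a b c d); intro
  end.
ring.
Qed.

Let e0 : 'rV[R]_(1 + q) := pvec 1 0.
Let m0 X := pvec 0 X.
(** [f * Kw] is the warped curvature tensor on four fiber vectors. *)
Let Kw X1 X2 X3 X4 :=
  K X1 X2 X3 X4 + w * (h X2 X3 * h X1 X4 - h X1 X3 * h X2 X4).

Let rD X Y : r (X + Y) = r X + r Y.
Proof. exact: (ricci0_opD hg). Qed.

Let rZ a X : r (a *: X) = a *: r X.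
Proof. exact: (ricci0_opZ hg). Qed.

Let rN X : r (- X) = - r X.
Proof. by rewrite -scaleN1r rZ scaleN1r. Qed.

Let r0 : r 0 = 0.
Proof. by have := rZ 0 0; rewrite !scale0r. Qed.

Let zeros := (mul0r, mulr0, add0r, addr0, subr0, sub0r, oppr0, scale0r, scaler0).

Lemma Q_S_R_mixed X2 X3 X4 Y :
  Q_S_R G p e0 (m0 X2) (m0 X3) (m0 X4) e0 (m0 Y)
  = - (q%:R * u * Kw Y X2 X3 X4
       + u * (h (A' Y) X3 * h X2 X4 - h X2 X3 * h (A' Y) X4)).
Proof.
rewrite /Q_S_R /tachibana /op_dot /wedge /e0 /m0 !ricci_pvec !pvec_lin.
rewrite !tensor_R_pvec /Kw /A' !r0 !(Klin, hlin) !zeros.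
by atoms; field; rewrite ?q_neq0 ?f_neq0.
Qed.

Lemma riem_op_time z Y Z : riem_op G p e0 (m0 Y) (pvec z Z)
  = pvec (u * h Y Z) ((u / f * z) *: Y).
Proof.
rewrite riemG /Rt; have := KZl 0 0.
have -> : riem_op gam s 0 Y Z = 0.
  by have := riem_opZl hg 0 0 Y Z Op; rewrite !scale0r.
by rewrite hlin !zeros scale1r mul1r.
Qed.

Lemma riem_op_space z X Y Z : riem_op G p (m0 X) (m0 Y) (pvec z Z)
  = m0 (Rt X Y Z + w *: (h Y Z *: X - h X Z *: Y)).
Proof. by rewrite riemG !zeros. Qed.

(** The endomorphism that describes [weyl_corr] on a plane through the time direction; [chat]
    cancels there between the Ricci operator and the scalar curvature term. *)
Let B' X := r X + ((q%:R - 1) * u) *: X.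

Lemma weyl_corr_time z Y Z : weyl_corr e0 (m0 Y) (pvec z Z)
  = pvec (h (B' Y) Z) ((z / f) *: B' Y).
Proof.
rewrite weyl_corr_pvec /A' /B' /lambda !r0 !hlin !zeros.
congr pvec; first by atoms; field; rewrite ?q_neq0 ?f_neq0.
by apply/rowP => i; rewrite !mxE; atoms; field; rewrite ?f_neq0.
Qed.

Lemma weyl_corr_space z X Y Z : weyl_corr (m0 X) (m0 Y) (pvec z Z)
  = m0 (h (r Y) Z *: X - h X Z *: r Y + h Y Z *: r X - h (r X) Z *: Y
        + chat *: (h Y Z *: X - h X Z *: Y)).
Proof.
rewrite weyl_corr_pvec /A' /lambda !hlin !zeros; congr pvec.
by apply/rowP => i; rewrite !mxE; atoms; field; rewrite ?f_neq0.
Qed.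

Lemma weyl_corr_ee c z Z : weyl_corr e0 (pvec c 0) (pvec z Z) = 0.
Proof.
rewrite weyl_corr_pvec /A' /lambda !r0 !hlin !zeros -[RHS](scale0r e0) pvec_lin.
by rewrite !zeros; congr pvec; field; rewrite f_neq0.
Qed.
Lemma comm_tensor_mixed X2 X3 X4 Y :
  let b' := 2 *: r Y + chat *: Y in
  comm_tensor e0 (m0 X2) (m0 X3) (m0 X4) e0 (m0 Y)
  = - (Kw (B' Y) X2 X3 X4 + u * (h b' X3 * h X2 X4 - h X2 X3 * h b' X4)).
Proof.
rewrite /comm_tensor /corr_tensor /op_dot.
rewrite (riem_op_time 1 Y 0) !(riem_op_time 0 Y) hlin !zeros.
rewrite (weyl_corr_time 1 Y 0) !(weyl_corr_time 0 Y) hlin !zeros.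
rewrite (weyl_corr_ee _ 0 X3) (weyl_corr_space 0 _ X2 X3).
rewrite !(weyl_corr_time _ X2) metric0l.
rewrite !tensor_R_pvec !metricG /Kw /B' !rZ !(Klin, hlin) !zeros.
by atoms; field; rewrite f_neq0.
Qed.

Let rC X Y : h (r X) Y = h X (r Y).
Proof. exact: (ricci0_op_sym hg). Qed.

Let Kskew X Y Z V : K X Y Z V = - K X Y V Z.
Proof.
apply/eqP; rewrite -addr_eq0 {2}/K [h (Rt X Y V) Z]hC; apply/eqP.
exact: (riem_op_skew hg).
Qed.

Local Notation curv_r := (riem_dot_ricci0 gam s).
Local Notation Q_r := (Q_ricci0 gam s).

Lemma Q_S_R_time X2 X3 X Y :
  Q_S_R G p e0 (m0 X2) (m0 X3) e0 (m0 X) (m0 Y) = u * Q_r X Y X2 X3.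
Proof.
rewrite /Q_S_R /tachibana /op_dot /wedge /e0 /m0 !ricci_pvec !pvec_lin.
rewrite !tensor_R_pvec /Q_ricci0 -/h -/r !(Klin, hlin) !zeros.
by rewrite [h X2 X]hC [h X2 Y]hC; atoms; field; rewrite ?q_neq0 ?f_neq0.
Qed.

(** With time in slots 1 and 4, [tensor_R] is a multiple of [h] and is annihilated by the skew
    operator [weyl_corr (m0 X) (m0 Y)]. The correction tensor is [- h (B' X2) X3] there; its scalar
    part is annihilated by the skew curvature operator, so only the traceless Ricci tensor
    survives. *)
Lemma comm_tensor_time X2 X3 X Y :
  comm_tensor e0 (m0 X2) (m0 X3) e0 (m0 X) (m0 Y)
  = w * Q_r X Y X2 X3 - curv_r X Y X2 X3.
Proof.
rewrite /comm_tensor /corr_tensor /op_dot.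
rewrite !(riem_op_space 1 _ _ 0) !(riem_op_space 0).
rewrite !(weyl_corr_space 1 _ _ 0) !(weyl_corr_space 0).
rewrite !(weyl_corr_time 0) /riem_dot_ricci0 /Q_ricci0 /B' -/h -/r -/Rt.
move: (Kskew X Y X2 X3); rewrite /K.
generalize (Rt X Y X2) (Rt X Y X3) => U V skew.
rewrite !hlin !zeros !tensor_R_pvec !metricG !(rD, rZ, rN) !(Klin, hlin) !zeros.
rewrite (hC X2 V) skew ![h (r X2) _]rC ![h X2 _]hC.
by atoms; ring.
Qed.

Let KwDl X Y X2 X3 X4 : Kw (X + Y) X2 X3 X4 = Kw X X2 X3 X4 + Kw Y X2 X3 X4.
Proof. by rewrite /Kw KDl !hlin; atoms; ring. Qed.

Let KwZl a X X2 X3 X4 : Kw (a *: X) X2 X3 X4 = a * Kw X X2 X3 X4.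
Proof. by rewrite /Kw KZl !hlin; atoms; ring. Qed.

(** Both [comm_tensor_mixed] and [Q_S_R_mixed] have this shape, with [Z] and [V] linear in [Y] and
    [r Y]. Contracting [X2] with [X4] turns the unknown fiber curvature into its Ricci tensor and
    leaves an equation in [r] alone. *)
Lemma trace_mixed Z V :
  (forall X2 X3 X4,
     Kw Z X2 X3 X4 + (h V X3 * h X2 X4 - h X2 X3 * h V X4) = 0) ->
  r Z + chat *: Z = (q%:R - 1) *: V.
Proof.
move=> E; apply: (metric_inj unit_s) => X3; rewrite -/(h _ _) -/(h _ _).
have : fun_tr (fun X2 => Rt Z X2 X3 + ((w *: (h X3 X2 *: Z)
     + (h V X3 - w * h Z X3) *: X2) + - (h X3 X2 *: V))) = 0.
  rewrite (_ : (fun _ => _) = fun=> 0); first by rewrite fun_trE big1 // => i _; rewrite mxE.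
  apply/funext => X2; apply: (metric_inj unit_s) => X4; rewrite -/(h _ _) -/(h _ _).
  rewrite h0l -(E X2 X3 X4) /Kw /K (hC X3 X2); generalize (Rt Z X2 X3) => U.
  by rewrite !hlin; atoms; ring.
have -> : forall a b U1 U2 (T : 'rV[R]_q -> 'rV[R]_q), fun_tr (fun V => T V +
    ((a *: (h X3 V *: U1) + b *: V) + - (h X3 V *: U2)))
  = fun_tr T + ((a * h X3 U1 + b * q%:R) - h X3 U2).
  move=> a b U1 U2 T; rewrite fun_trD (fun_trD (fun V => a *: _ + _)).
  rewrite (fun_trD (fun V => a *: _)) !fun_trZ fun_trN fun_tr_id.
  by rewrite !(fun_tr_metricr gam s).
rewrite (_ : fun_tr (fun V => _ Z V X3) = - ricci gam s Z X3); last exact: riem_trm.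
rewrite (ricci_ricci0 hg Op) -/s -/r -/(h _ _) -/(h _ _) => E3.
apply/eqP; rewrite -subr_eq0 -oppr_eq0 -E3 !hlin (hC X3) (hC X3) /chat; apply/eqP.
atoms; ring.
Qed.

(** This makes the condition available wherever [u] and [r] are nonzero. The trace reads
    [q (r + chat) = (q - 1) (r + chat + u)], so [r] is a multiple of the identity and hence zero. *)
Lemma Q_S_R_eq0 : u != 0 ->
  (forall X1 X2 X3 X4 X Y : 'rV[R]_(1 + q), Q_S_R G p X1 X2 X3 X4 X Y = 0) ->
  forall Y, r Y = 0.
Proof.
move=> u0 Q0; apply: (@ricci0_op_scalar _ _ _ _ ((q%:R - 1) * u - chat)) => // Y.
have : r ((q%:R * u) *: Y) + chat *: ((q%:R * u) *: Y)
    = (q%:R - 1) *: (u *: A' Y).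
  apply: trace_mixed => X2 X3 X4.
  apply/eqP; rewrite -oppr_eq0 -(Q0 e0 (m0 X2) (m0 X3) (m0 X4) e0 (m0 Y)).
  by rewrite Q_S_R_mixed KwZl !hlin; apply/eqP; atoms; ring.
rewrite rZ /A' => E; apply: (scalerI u0); apply/rowP => i.
by move/rowP/(_ i): E; rewrite !mxE => E; apply/eqP; rewrite -subr_eq0; apply/eqP;
  move/eqP: E; rewrite -subr_eq0 => /eqP <-; ring.
Qed.

Section Condition.
Variable ell : R.
Hypothesis comm_eq : forall X1 X2 X3 X4 X Y : 'rV[R]_(1 + q),
  comm_tensor X1 X2 X3 X4 X Y = ell * Q_S_R G p X1 X2 X3 X4 X Y.

(** Tracing the mixed components leaves a quadratic polynomial in [r] whose coefficients factor as
    [(r + theta) (r - m)]. The number [ell] stands for [(n - 2) L]. *)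
Lemma ricci0_op_quad Y :
  let m := ell * u in let theta := chat - (q%:R - 1) * u in
  r (r Y) = (m - theta) *: r Y + (m * theta) *: Y.
Proof.
move=> m theta.
have : r (B' Y - (m * q%:R) *: Y) + chat *: (B' Y - (m * q%:R) *: Y)
    = (q%:R - 1) *: (u *: (2 *: r Y + chat *: Y) - m *: A' Y).
  apply: trace_mixed => X2 X3 X4.
  have := comm_eq e0 (m0 X2) (m0 X3) (m0 X4) e0 (m0 Y).
  move/eqP; rewrite comm_tensor_mixed Q_S_R_mixed -subr_eq0 -oppr_eq0 => /eqP <-.
  rewrite KwDl -scaleNr KwZl /m /A' !hlin.
  by generalize (Kw (B' Y) X2 X3 X4) (Kw Y X2 X3 X4) => ? ?; atoms; ring.
rewrite /B' /A' !(rD, rZ, rN) => E; apply/rowP => i.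
move/rowP/(_ i): E; rewrite !mxE => E; apply/eqP; rewrite -subr_eq0; apply/eqP.
by move/eqP: E; rewrite -subr_eq0 => /eqP <-; rewrite /theta; ring.
Qed.

Lemma riem_dot_ricci0_eq X Y X2 X3 : curv_r X Y X2 X3 = (w - ell * u) * Q_r X Y X2 X3.
Proof.
have := comm_eq e0 (m0 X2) (m0 X3) e0 (m0 X) (m0 Y).
rewrite comm_tensor_time Q_S_R_time mulrA mulrBl => <-.
by rewrite opprB addrCA subrr addr0.
Qed.

End Condition.

(** Here the Ricci tensor is [chat * h] on the fiber and vanishes on time. Hence [weyl_corr] agrees
    with the wedge of the Ricci tensor up to a time component, which the curvature tensor ignores
    when [u = 0]; this gives [E . R = Q(S,R)]. *)
Lemma comm_tensor_static (X1 X2 X3 X4 X Y : 'rV[R]_(1 + q)) :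
  u = 0 -> (forall Z, r Z = 0) ->
  comm_tensor X1 X2 X3 X4 X Y = Q_S_R G p X1 X2 X3 X4 X Y.
Proof.
move=> u0 rr0.
have corrE x y z (A B C : 'rV[R]_q) : weyl_corr (pvec x A) (pvec y B) (pvec z C)
    = m0 (chat *: (h B C *: A - h A C *: B)).
  rewrite weyl_corr_pvec /A' /lambda !rr0 !hlin u0 !zeros; congr pvec.
    by atoms; field.
  by apply/rowP => i; rewrite !mxE; atoms; field.
have [x1 [V1 ->]] := pvec_surj X1; have [x2 [V2 ->]] := pvec_surj X2.
have [x3 [V3 ->]] := pvec_surj X3; have [x4 [V4 ->]] := pvec_surj X4.
have [x [V ->]] := pvec_surj X; have [y [W ->]] := pvec_surj Y.
pose T a := Rt V W a + w *: (h W a *: V - h V a *: W).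
have skew a b : h (T a) b = - h (T b) a.
  have := Kskew V W a b; rewrite /K /T.
  generalize (Rt V W a) (Rt V W b) => A B E.
  by rewrite !hlin E; atoms; ring.
rewrite /comm_tensor /Q_S_R /tachibana /corr_tensor /op_dot !riemG u0 !zeros.
rewrite !corrE /wedge !ricci_pvec !rr0 u0 !zeros !pvec_lin.
have E : forall a b, a = b -> forall c : R, c = 0 -> a - c = b.
  by move=> a b -> c ->; rewrite subr0.
(* The second goal is [R . E = 0]: the correction tensor is built from [h] alone, and the operator
   [T] is skew for [h]. *)
apply: E.
  rewrite !tensor_R_pvec u0 !(Klin, hlin) !zeros.
  by atoms; ring.
rewrite -!/(T _); move: (skew V1 V3) (skew V1 V4).
move: (skew V2 V3) (skew V2 V4).
generalize (T V1) (T V2) (T V3) (T V4) => T1 T2 T3 T4 s23 s24 s13 s14.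
rewrite !metricG !hlin !(hC _ T3) !(hC _ T4).
by rewrite s13 s14 s23 s24; atoms; ring.
Qed.

End WarpedCurvature.

(** * The warping function *)

(** For a full-rank factorization [E = C B], idempotency forces [B C = 1], whose size is the rank,
    and [E] and [B C] have the same trace. *)
Lemma mxtrace_idempotent (F : fieldType) (n : nat) (E : 'M[F]_n) :
  E *m E = E -> \tr E = (\rank E)%:R.
Proof.
move=> EE; have := mulmx_base E.
have /row_freeP[B' BB'] := row_base_free E.
have /row_fullP[C' CC'] := col_base_full E.
move: (col_base E) (row_base E) BB' CC' => C B BB' CC' EB.
have BC : B *m C = 1%:M.
  have : C' *m (C *m B *m (C *m B)) *m B' = C' *m (C *m B) *m B'.
    by rewrite EB EE.
  by rewrite !mulmxA CC' !mul1mx -[_ *m B *m B']mulmxA BB' mulmx1.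
by rewrite -[in LHS]EB mxtrace_mulC BC mxtrace1.
Qed.

(** If [c = 0], then [g(r X, r X) = g(X, r (r X)) = 0] and definiteness applies. Otherwise [r / c]
    is idempotent with trace zero, so in characteristic zero its rank is zero. *)
Lemma ricci0_op_quasi_idempotent (R : realType) (d : nat) (O : set 'rV[R]_d)
    (g : 'rV[R]_d -> 'M[R]_d) (y : 'rV[R]_d) (c : R) :
  local_metric O g -> O y -> (0 < d)%N ->
  (forall X, X != 0 -> 0 < metric g y X X) ->
  (forall X, ricci0_op g y (ricci0_op g y X) = c *: ricci0_op g y X) ->
  forall X, ricci0_op g y X = 0.
Proof.
move=> hg Oy d0 pos E.
have [c0|c0] := eqVneq c 0.
  move=> X; apply/eqP/negPn/negP => /pos.
  by rewrite (ricci0_op_sym hg) // E c0 scale0r metric0r ltxx.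
pose M := lin1_mx (ricci0_op g y).
have ME X : X *m M = ricci0_op g y X.
  rewrite [in RHS](row_sum X) mulmx_sum_row.
  elim/big_rec2: _ => [|i a b _ IH].
    by have := ricci0_opZ hg Oy 0 0; rewrite !scale0r.
  rewrite (ricci0_opD hg) // (ricci0_opZ hg) // IH; congr (_ *: _ + _).
  by apply/rowP => j; rewrite !mxE.
have MM : (c^-1 *: M) *m (c^-1 *: M) = c^-1 *: M.
  apply/row_matrixP => i; rewrite !rowE mulmxA -!scalemxAr !ME.
  by rewrite (ricci0_opZ hg) // E !scalerA mulVf // mulr1.
have := mxtrace_idempotent MM.
rewrite linearZ /= [\tr M](ricci0_op_tr _ _ d0) mulr0 => /esym/eqP.
rewrite pnatr_eq0 mxrank_eq0 scaler_eq0 invr_eq0 (negPf c0) /= => /eqP M0 X.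
by rewrite -ME M0 mulmx0.
Qed.

(** Contracting [X] with [X3] leaves [d * h (r Y) X2]: two rank-one terms cancel and [r] is
    traceless. It supplies a nonzero entry of [Q_ricci0] by which to divide. *)
Lemma Q_ricci0_eq0 (R : realType) (d : nat) (O : set 'rV[R]_d)
    (g : 'rV[R]_d -> 'M[R]_d) (y : 'rV[R]_d) :
  local_metric O g -> O y -> (0 < d)%N ->
  (forall X Y X2 X3, Q_ricci0 g y X Y X2 X3 = 0) ->
  forall X, ricci0_op g y X = 0.
Proof.
move=> hg Oy d0 Q0 Y.
have gu : g y \in unitmx by case: hg => _ _ _; apply.
set r := ricci0_op g y in Q0 *; set h := metric g y.
have hC X Z : h X Z = h Z X by exact: (metric_symO hg).
have rC X Z : h (r X) Z = h X (r Z) by exact: (ricci0_op_sym hg).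
apply: (metric_inj gu) => X2; rewrite metric0l -/(h _ _).
have rtr : fun_tr r = 0 by exact: ricci0_op_tr.
have : fun_tr (fun X => (h (r Y) X2 *: X + - (h (r X2) X *: Y))
    + (h X2 X *: r Y + - h Y X2 *: r X)) = 0.
  rewrite (_ : (fun _ => _) = fun=> 0).
    by rewrite fun_trE big1 // => i _; rewrite mxE.
  apply/funext => X; apply: (metric_inj gu) => X3.
  rewrite metric0l -[RHS](Q0 X Y X2 X3) /Q_ricci0 -/h -/r.
  rewrite /h !metricDl !metricNl !metricZl -/h (hC X X2) (hC (r X2) X) -rC.
  ring.
rewrite fun_trD (fun_trD (fun X => h (r Y) X2 *: X)).
rewrite (fun_trD (fun X => h X2 X *: r Y)) fun_trN !fun_trZ fun_tr_id rtr.
rewrite !(fun_tr_metricr g y) -!/(h _ _) mulr0 addr0 (hC X2) (hC _ Y) -rC.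
rewrite subrK => /eqP; rewrite mulf_eq0 pnatr_eq0 gtn_eqF // orbF.
by move/eqP.
Qed.

(** * Functions of time on an interval *)

Section Line.
Variables (R : realType) (I : set 'rV[R]_1).
Hypothesis intervalI : forall y z : 'rV[R]_1, I y -> I z ->
  forall a, y 0 0 <= a <= z 0 0 -> I (const_mx a).
Implicit Types (y z : 'rV[R]_1) (f : 'rV[R]_1 -> R).

Lemma constant_slope f k :
  (forall y, I y -> pderivable f y) -> (forall y, I y -> partial 0 f y = k) ->
  forall y z, I y -> I z -> f z = f y + k * (z 0 0 - y 0 0).
Proof.
move=> df pf.
have lineE y : 0 + y 0 0 *: delta_mx 0 0 = y.
  by rewrite add0r; apply/rowP => i; rewrite (ord1 i) !mxE !eqxx mulr1.
have constE a : 0 + a *: delta_mx 0 0 = const_mx a :> 'rV[R]_1.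
  by rewrite add0r; apply/rowP => i; rewrite (ord1 i) !mxE !eqxx mulr1.
have lt y z : I y -> I z -> y 0 0 < z 0 0 -> f z = f y + k * (z 0 0 - y 0 0).
  move=> Iy Iz yz.
  have [|c /andP[yc cz]] := @MVT_line R 1 f 0 (delta_mx 0 0) _ _ yz.
    by move=> a yaz; rewrite constE; apply: (df _ (intervalI Iy Iz yaz)).
  have Ic : I (const_mx c) by apply: (intervalI Iy Iz); rewrite !ltW.
  rewrite !lineE constE -/(partial 0 f _) pf // => <-.
  by rewrite addrC subrK.
move=> y z Iy Iz; case: (ltgtP (y 0 0) (z 0 0)) => [|zy|yz]; first exact: lt.
  by rewrite (lt z y) //; ring.
have -> : z = y by apply/rowP => i; rewrite (ord1 i).
by rewrite subrr mulr0 addr0.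
Qed.

Variable phi : 'rV[R]_1 -> R.
Hypothesis hphi : warping I phi.

(** First [w' = 0], so [w] is constant; then [phi'' = 2 w] makes [phi'] affine. Since
    [phi'^2 = 4 w phi], for [w <> 0] the function [phi] is the square of the affine function
    [phi' / (2 a)] with [a = sqrt w]; for [w = 0] it is constant. *)
Lemma warped_square : (forall y, I y -> warp_u phi y = 0) ->
  exists a b, forall y, I y ->
    phi y = (a * y 0 0 + b) ^+ 2 /\ warp_w phi y = a ^+ 2.
Proof.
move=> u0; have [_ sphi phi_gt0] := hphi.
have [[y0 Iy0]|noI] := pselect (exists y, I y); last first.
  by exists 0, 0 => y Iy; case: noI; exists y.
have dphi1 y : I y -> pderivable (phi1 phi) y.
  by move=> Iy; apply: smooth_pderivable (smooth_phi1 hphi) Iy.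
pose w := warp_w phi y0.
have wE y : I y -> warp_w phi y = w.
  move=> Iy; rewrite (@constant_slope _ 0 _ _ _ _ Iy0 Iy).
  - by rewrite mul0r addr0.
  - by move=> z Iz; apply: (@pderivable_warp_w _ _ _ hphi z Iz).
  - by move=> z Iz; rewrite (partial_warp_w hphi) // u0 // mulr0 mul0r.
have phi1E y : I y -> phi1 phi y = phi1 phi y0 + 2 * w * (y 0 0 - y0 0 0).
  move=> Iy; apply: constant_slope => // z Iz; rewrite -/(phi2 phi z).
  by have := u0 _ Iz; rewrite /warp_u wE // => /eqP; rewrite subr_eq0 => /eqP <-; field.
have sq y : I y -> phi1 phi y ^+ 2 = 4 * w * phi y.
  move=> Iy; have p0 : phi y != 0 by rewrite gt_eqF ?phi_gt0.
  by rewrite -(wE y) // /warp_w; field.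
have w_ge0 : 0 <= w.
  by rewrite /w /warp_w divr_ge0 ?sqr_ge0 // mulr_ge0 // ltW ?phi_gt0.
have [w0|w_neq0] := eqVneq w 0.
  have phiE y : I y -> phi y = phi y0.
    move=> Iy; rewrite (@constant_slope _ 0 _ _ _ _ Iy0 Iy).
    - by rewrite mul0r addr0.
    - by move=> z Iz; apply: smooth_pderivable sphi Iz.
    - move=> z Iz; apply/eqP; rewrite -sqrf_eq0 -/(phi1 phi z) sq //.
      by rewrite w0 mulr0 mul0r.
  exists 0, (Num.sqrt (phi y0)) => y Iy; split; last by rewrite wE // w0 expr0n.
  by rewrite mul0r add0r sqr_sqrtr ?phiE // ltW // phi_gt0.
pose a := Num.sqrt w; have a2 : a ^+ 2 = w by rewrite sqr_sqrtr.
have a0 : a != 0 by rewrite -sqrf_eq0 a2.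
exists a, ((phi1 phi y0 - 2 * w * y0 0 0) / (2 * a)) => y Iy.
split; last by rewrite wE.
have -> : a * y 0 0 + (phi1 phi y0 - 2 * w * y0 0 0) / (2 * a)
    = phi1 phi y / (2 * a) by rewrite (phi1E y) // -a2; field.
by rewrite exprMn exprVn exprMn a2 sq //; field.
Qed.

Lemma continuous_warp_u y : I y -> {for y, continuous (warp_u phi)}.
Proof.
move=> Iy; have [_ sphi phi_gt0] := hphi.
have c0 : {for y, continuous phi} by exact: smooth_continuous sphi Iy.
have c1 : {for y, continuous (phi1 phi)}.
  exact: smooth_continuous (smooth_phi1 hphi) Iy.
have c2 : {for y, continuous (phi2 phi)}.
  exact: smooth_continuous (smooth_phi2 hphi) Iy.
rewrite (_ : warp_u phi = fun z => phi2 phi z * 2^-1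
  - phi1 phi z * phi1 phi z * (4 * phi z)^-1); last exact/funext.
have cc (k : R) : {for y, continuous (fun=> k : R)} by exact: cst_continuous.
apply: continuousB; first exact: (continuousM c2 (cc _)).
apply: continuousM; first exact: (continuousM c1 c1).
apply: continuousV; first by rewrite mulf_neq0 // gt_eqF ?phi_gt0.
exact: (continuousM (cc _) c0).
Qed.

End Line.

(** * Time varies over one fixed fiber point *)

Section NonEinsteinFiber.
Variables (R : realType) (q : nat).
Variables (I : set 'rV[R]_1) (phi : 'rV[R]_1 -> R).
Variables (O : set 'rV[R]_q) (gam : 'rV[R]_q -> 'M[R]_q).
Variable G : 'rV[R]_(1 + q) -> 'M[R]_(1 + q).
Hypothesis q_gt0 : (0 < q)%N.
Hypothesis hphi : warping I phi.
Hypothesis hg : local_metric O gam.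
Hypothesis G_block : forall y, I (lsubmx y) -> O (rsubmx y) ->
  G y = block_mx (-1)%:M 0 0 (phi (lsubmx y) *: gam (rsubmx y)).
Variable s : 'rV[R]_q.
Hypothesis Os : O s.
Hypothesis comm_eq : forall t, I t ->
  (exists X1 X2 X3 X4 X Y, Q_S_R G (row_mx t s) X1 X2 X3 X4 X Y != 0) ->
  exists ell, forall X1 X2 X3 X4 X Y,
    comm_tensor G (row_mx t s) X1 X2 X3 X4 X Y
    = ell * Q_S_R G (row_mx t s) X1 X2 X3 X4 X Y.

Let r := ricci0_op gam s.
Let U := [set t | I t /\ warp_u phi t != 0].

Let near_U t : U t -> \near t, U t.
Proof.
move=> [It ut]; have [openI _ _] := hphi.
have nu := cvgr_neq0 (warp_u phi t) (continuous_warp_u hphi It) ut.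
by near=> t'; split; near: t'; [exact: near_open|exact: nu].
Unshelve. all: by end_near. Qed.

(* Given that [ricci0_op] is not a multiple of the identity, its quadratic
   equation pins down [m - theta] and [m * theta]. *)
Lemma quadratic_at t : (exists X, r X != 0) -> U t ->
  exists m theta, [/\ forall X, r (r X) = (m - theta) *: r X + (m * theta) *: X &
    forall X Y X2 X3, riem_dot_ricci0 gam s X Y X2 X3
      = (warp_w phi t - m) * Q_ricci0 gam s X Y X2 X3].
Proof.
move=> [X rX] [It ut].
have It' : I (lsubmx (row_mx t s)) by rewrite row_mxKl.
have Os' : O (rsubmx (row_mx t s)) by rewrite row_mxKr.
have [|ell E] := comm_eq It.
  (* If [Q(S,R)] vanished here, [Q_S_R_eq0] would give [r = 0]. *)
  apply: contrapT => Q0.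
  have := Q_S_R_eq0 q_gt0 hphi hg G_block It' Os'; rewrite row_mxKl row_mxKr.
  move=> /(_ ut) H; move/eqP: rX; apply; apply: H => X1 X2 X3 X4 Y Z.
  by apply/eqP/negPn/negP => QX; apply: Q0; exists X1, X2, X3, X4, Y, Z.
have E1 := ricci0_op_quad q_gt0 hphi hg G_block It' Os' E.
have E2 := riem_dot_ricci0_eq q_gt0 hphi hg G_block It' Os' E.
rewrite row_mxKl row_mxKr in E1 E2.
by do 2 eexists; split; [exact: E1|exact: E2].
Qed.

Lemma warp_w_quadratic t0 : (exists X, r X != 0) -> U t0 ->
  exists c D, forall t, U t -> (2 * warp_w phi t + c) ^+ 2 = D.
Proof.
move=> r_neq0 Ut0.
have scal a : (forall X, r X = a *: X) -> False.
  move=> E; have [X /eqP] := r_neq0; apply.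
  exact: (ricci0_op_scalar q_gt0 E).
have [m0 [th0 [E0 F0]]] := quadratic_at r_neq0 Ut0.
have [X [Y [X2 [X3 Q0]]]] :
    exists X Y X2 X3, Q_ricci0 gam s X Y X2 X3 != 0.
  apply: contrapT => Q0; have [X /eqP] := r_neq0; apply.
  apply: (Q_ricci0_eq0 hg Os q_gt0) => X' Y X2 X3.
  by apply/eqP/negPn/negP => QX; apply: Q0; exists X', Y, X2, X3.
(* The witnesses are chosen so that [2 w + c = m + theta] at every [t]; its square
   [(m - theta)^2 + 4 m theta] is evaluated at [t0]. *)
exists (- (2 * (warp_w phi t0 - m0) + (m0 - th0))), ((m0 + th0) ^+ 2) => t Ut.
have [m [th [E F]]] := quadratic_at r_neq0 Ut.
have Ew : warp_w phi t - m = warp_w phi t0 - m0.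
  by apply: (mulIf Q0); rewrite -F -F0.
(* Subtracting the quadratic equations at [t] and [t0] leaves a linear relation between [r] and the
   identity, so both of its coefficients vanish. *)
have D V : (m - th - (m0 - th0)) *: r V = (m0 * th0 - m * th) *: V.
  apply/rowP => i; apply/eqP; rewrite -subr_eq0; apply/eqP.
  have /rowP/(_ i)/eqP := etrans (esym (E V)) (E0 V).
  by rewrite !mxE -subr_eq0 => /eqP <-; ring.
have Es : m - th = m0 - th0.
  apply/eqP; rewrite -subr_eq0; apply/negPn/negP => n0.
  apply: (scal ((m - th - (m0 - th0))^-1 * (m0 * th0 - m * th))) => V.
  by rewrite -scalerA -D scalerA mulVf // scale1r.
have Ep : m * th = m0 * th0.
  have := D (const_mx 1); rewrite Es subrr scale0r => /rowP/(_ (Ordinal q_gt0)).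
  by rewrite !mxE mulr1 => /esym/eqP; rewrite subr_eq0 => /eqP.
have -> : 2 * warp_w phi t - (2 * (warp_w phi t0 - m0) + (m0 - th0)) = m + th.
  by rewrite -Ew -Es; ring.
have -> : (m + th) ^+ 2 = (m - th) ^+ 2 + 4 * (m * th) by ring.
by rewrite Es Ep; ring.
Qed.

Lemma warp_u_eq0 : (exists X, r X != 0) -> forall t, I t -> warp_u phi t = 0.
Proof.
move=> r_neq0 t0 It0; apply/eqP/negPn/negP => ut0.
have [openI sphi phi_gt0] := hphi.
have Ut0 : U t0 by [].
have [c [D E]] := warp_w_quadratic r_neq0 Ut0.
have dw t : U t -> pderivable (warp_w phi) t.
  by move=> [It _]; apply: (@pderivable_warp_w _ _ _ hphi t It).
have dw0 t : U t -> partial 0 (warp_w phi) t = 0.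
  move=> Ut; rewrite -dirder1.
  (* For [D = 0] differentiating the square gives no information, but [w = - c / 2] outright;
     otherwise the factor [2 w + c] is nonzero and cancels. *)
  have [D0|D0] := eqVneq D 0.
    rewrite (@dirder_near _ _ _ _ (fun=> - c / 2)) ?dirder_cst //.
    near=> t'; have Ut' : U t' by near: t'; apply: near_U.
    have /eqP := E t' Ut'; rewrite D0 sqrf_eq0 => /eqP H.
    have -> : c = - (2 * warp_w phi t') by apply/eqP; rewrite -addr_eq0 addrC H.
    by field.
  pose x t := 2 * warp_w phi t + c.
  have dx : pderivable x t.
    apply: pderivableD; last exact: pderivable_cst.
    by apply: pderivableM; [exact: pderivable_cst|exact: dw].
  have : dirder (delta_mx 0 0) (fun t => x t * x t) t = 0.
    rewrite (@dirder_near _ _ _ _ (fun=> D)) ?dirder_cst //.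
    near=> t'; have Ut' : U t' by near: t'; apply: near_U.
    by rewrite -expr2 E.
  rewrite dirderM // -mulr2n => /eqP; rewrite mulrn_eq0 mulf_eq0 /=.
  have /negPf-> : x t != 0 by rewrite -sqrf_eq0 /x E.
  rewrite dirderD; [|apply: pderivableM; [exact: pderivable_cst|exact: dw]|exact: pderivable_cst].
  rewrite dirder_cst addr0 dirderZ; last exact: dw.
  by rewrite mulf_eq0 pnatr_eq0 => /eqP.
have p10 t : U t -> phi1 phi t = 0.
  move=> Ut; have [It ut] := Ut; have /eqP := dw0 t Ut.
  rewrite (partial_warp_w hphi) // !mulf_eq0 invr_eq0 (negPf ut).
  by rewrite (gt_eqF (phi_gt0 t It)) !orbF => /eqP.
(* [phi'] vanishes on a whole neighborhood, hence [phi''] vanishes too, contradicting [u <> 0]. *)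
have p20 : phi2 phi t0 = 0.
  rewrite /phi2 -dirder1 (@dirder_near _ _ _ _ (fun=> 0)) ?dirder_cst //.
  by near=> t; apply: p10; near: t; apply: near_U.
move/eqP: ut0; apply; rewrite /warp_u /warp_w p20 p10 // expr0n.
by rewrite !mul0r subrr.
Unshelve. all: by end_near. Qed.

End NonEinsteinFiber.

(** * Charts and the theorem *)

Section Manifold.
Variables (R : realType) (d : nat) (M : smoothManifold R d).

Lemma atlas_is_chart (c : chart R d M) : atlas c -> is_chart c.
Proof. by case: M c. Qed.

Lemma local_metric_chart (g : semiRiemMetric M) (c : chart R d M) :
  atlas c -> local_metric (chart_img c) (g c).
Proof.
move=> hc; have [_ oc _ _ _] := atlas_is_chart hc.
by case: g => g sm sy un tr; split=> //= *; [apply: sm|apply: sy|apply: un].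
Qed.

Lemma chart_img_map (c : chart R d M) x : chart_dom c x -> chart_img c (c x).
Proof. by move=> dx; exists x. Qed.

Lemma chart_mapK (c : chart R d M) x :
  atlas c -> chart_dom c x -> chart_inv c (c x) = x.
Proof. by move=> /atlas_is_chart[_ _ + _ _]; apply. Qed.

End Manifold.

(** Connectedness of the chart domain is what makes one pair [a], [b] serve the whole chart. *)
Lemma interval_chart_img (R : realType) (M : smoothManifold R 1) (c : chart R 1 M) :
  atlas c -> connected (chart_dom c) ->
  forall y z : 'rV[R]_1, chart_img c y -> chart_img c z ->
  forall a, y 0 0 <= a <= z 0 0 -> chart_img c (const_mx a).
Proof.
move=> /atlas_is_chart[_ _ _ cc _] conn y z [p dp <-] [p' dp' <-] a yaz.
have : connected ((fun x => c x 0 0) @` chart_dom c).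
  apply: connected_continuous_connected => //.
  apply: continuous_in_subspaceT => x; rewrite inE => dx.
  apply: (@continuous_comp _ _ _ c (fun v : 'rV[R]_1 => v 0 0)); first exact: cc.
  exact: coord_continuous.
move=> /connected_intervalP itv.
have [||x dx E] := itv (c p 0 0) (c p' 0 0) _ _ a yaz; [by exists p|by exists p'|].
by exists x => //; apply/rowP => i; rewrite (ord1 i) mxE.
Qed.

Section GRW.
Variables (R : realType) (q : nat).
Variables (Mbar : smoothManifold R 1) (gbar : semiRiemMetric Mbar) (F : Mbar -> R).
Variables (N : smoothManifold R q) (gt : semiRiemMetric N).
Variables (c : chart R 1 Mbar) (d : chart R q N).
Hypothesis hF : smooth_function F.
Hypothesis F_gt0 : forall t, 0 < F t.
Hypothesis hc : time_coordinate gbar c.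

Let phi := F \o chart_inv c.
Let G := warped_metric gbar F gt c d.

Lemma warping_grw : warping (chart_img c) phi.
Proof.
have [ac _ _] := hc; have [_ oc _ _ _] := atlas_is_chart ac.
by split=> //; [exact: hF|move=> t _; exact: F_gt0].
Qed.

Lemma warped_metric_block y : chart_img c (lsubmx y) -> chart_img d (rsubmx y) ->
  G y = block_mx (-1)%:M 0 0 (phi (lsubmx y) *: gt d (rsubmx y)).
Proof.
move=> Iy _; have [_ _ g1] := hc; rewrite /G /warped_metric; congr block_mx.
by rewrite [LHS]mx11_scalar g1.
Qed.

End GRW.

Theorem corollary4p1 (R : realType) (n : nat) (hn : (4 <= n)%N)
  (Mbar : smoothManifold R 1) (gbar : semiRiemMetric Mbar) (F : Mbar -> R)
  (N : smoothManifold R n.-1) (gt : semiRiemMetric N)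
  (hgrw : grw_spacetime gbar F gt)
  (hfiber : ~ einstein gt)
  (L : Mbar * N -> R)
  (hL : forall (c : chart R 1 Mbar) (d : chart R n.-1 N) (z : Mbar * N),
     atlas c -> atlas d -> set_U gbar F gt c d z ->
     let g := warped_metric gbar F gt c d in
     let y := prod_coord c d z in
     forall X1 X2 X3 X4 X Y : 'rV[R]_(1 + n.-1),
       R_dot_C g y X1 X2 X3 X4 X Y - C_dot_R g y X1 X2 X3 X4 X Y
       = L z * Q_S_R g y X1 X2 X3 X4 X Y)
  (x1 : chart R 1 Mbar) (hx1 : time_coordinate gbar x1) :
  exists a b : R, forall (d : chart R n.-1 N) (z : Mbar * N), atlas d ->
    (set_U gbar F gt x1 d `&` set_US gbar F gt x1 d `&` set_UC gbar F gt x1 d) z ->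
    [/\ L z = (n%:R - 2)^-1,
        F z.1 = (a * x1 z.1 0 0 + b) ^+ 2 &
        let eps : R := -1 in
        let gd := gt d in
        let y := d z.2 in
        let kt := scalar_curv gd y in
        forall mu beta gamma delta : 'I_n.-1,
          \sum_(e < n.-1) ricci_mixed gd y mu e * riem_comp gd y e beta gamma delta
          = kt / (n%:R - 1) * riem_comp gd y mu beta gamma delta
            + eps * a ^+ 2 * (gd y beta gamma * ricci_comp gd y mu delta
                              - gd y beta delta * ricci_comp gd y mu gamma)
            - eps * kt * a ^+ 2 / (n%:R - 1) * G_comp gd y mu beta gamma delta].
Proof.
have [_ _ sF F_gt0 posg] := hgrw.
have [ax1 cx1 _] := hx1.
have q_gt0 : (0 < n.-1)%N by case: n hn {N gt hgrw hfiber L hL posg} => [|[]].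
have n_gt0 : (0 < n)%N by exact: leq_trans hn.
have nE : n%:R - 1 = n.-1%:R :> R by rewrite -{1}(prednK n_gt0) mulrSr addrK.
have nE2 : (1 + n.-1)%:R = n%:R :> R by rewrite add1n prednK.
have n2 : n%:R - 2 != 0 :> R by rewrite subr_eq0 eqr_nat gtn_eqF // (leq_trans _ hn).
pose phi := F \o chart_inv x1.
have hphi : warping (chart_img x1) phi by exact: warping_grw hx1.
have block d := @warped_metric_block _ _ _ gbar F _ gt x1 d hx1.
have rowl z (d : chart R n.-1 N) : lsubmx (prod_coord x1 d z) = x1 z.1.
  by rewrite row_mxKl.
have rowr z (d : chart R n.-1 N) : rsubmx (prod_coord x1 d z) = d z.2.
  by rewrite row_mxKr.
have comm (d : chart R n.-1 N) z : atlas d -> set_U gbar F gt x1 d z ->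
    forall X1 X2 X3 X4 X Y,
    comm_tensor (warped_metric gbar F gt x1 d) (prod_coord x1 d z) X1 X2 X3 X4 X Y
    = (n%:R - 2) * L z * Q_S_R (warped_metric gbar F gt x1 d) (prod_coord x1 d z)
        X1 X2 X3 X4 X Y.
  move=> ad Uz X1 X2 X3 X4 X Y.
  have [[dz1 dz2] _] := Uz.
  have := hL x1 d z ax1 ad Uz X1 X2 X3 X4 X Y.
  rewrite (R_dot_C_sub_C_dot_R hphi (local_metric_chart gt ad) (block d)).
  - by rewrite nE2 -mulrA => <-; rewrite mulVKf.
  - by rewrite rowl; apply: chart_img_map.
  - by rewrite rowr; apply: chart_img_map.
(* One chart point where the fiber is not Einstein decides this for all of the time coordinate. *)
have u0 : forall t, chart_img x1 t -> warp_u phi t = 0.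
  move/existsNP: hfiber => [d /not_implyP[ad /existsNP[x /not_implyP[dx nE0]]]].
  have hg := local_metric_chart gt ad.
  apply: (warp_u_eq0 q_gt0 hphi hg (block d) (chart_img_map dx)).
    move=> _ [t dt <-] Q0; exists ((n%:R - 2) * L (t, x)).
    by apply: (comm d (t, x) ad).
  apply: contrapT => r0; apply: nE0.
  apply/(einstein_ricci0 hg (chart_img_map dx)) => X.
  by apply/eqP/negPn/negP => rX; apply: r0; exists X.
have [a [b ab]] := warped_square (interval_chart_img ax1 cx1) hphi u0.
exists a, b => d z ad [[Uz _] _].
have [[dz1 dz2] [X1 [X2 [X3 [X4 [X [Y Q0]]]]]]] := Uz.
have hg := local_metric_chart gt ad.
have Iz := chart_img_map dz1; have Oz := chart_img_map dz2.
have [phiE wE] := ab _ Iz.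
have Iz' : chart_img x1 (lsubmx (prod_coord x1 d z)) by rewrite rowl.
have Oz' : chart_img d (rsubmx (prod_coord x1 d z)) by rewrite rowr.
(* With [u = 0] also [m = 0], and the quadratic equation becomes [r (r Z) = - theta r Z]. *)
have r0 : forall Z, ricci0_op (gt d) (d z.2) Z = 0.
  have := ricci0_op_quad q_gt0 hphi hg (block d) Iz' Oz' (comm d z ad Uz).
  rewrite rowl rowr u0 // => quad.
  apply: (ricci0_op_quasi_idempotent hg Oz q_gt0); first by move=> Z; apply: posg.
  by move=> Z; rewrite quad mulr0 mul0r scale0r addr0 sub0r mulr0 subr0.
(* The condition now reads [(n - 2) L Q(S,R) = Q(S,R)], evaluated at arguments where [Q(S,R)] is
   nonzero. *)
have LE : L z = (n%:R - 2)^-1.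
  have := comm_tensor_static q_gt0 hphi hg (block d) Iz' Oz' X1 X2 X3 X4 X Y.
  rewrite rowl rowr (comm d z ad Uz) => /(_ (u0 _ Iz) r0)/eqP.
  rewrite -subr_eq0 -{2}[Q_S_R _ _ _ _ _ _ _ _]mul1r -mulrBl mulf_eq0 (negPf Q0) orbF.
  by rewrite subr_eq0 => /eqP; move/(canRL (mulKf n2)); rewrite mulr1.
split=> //; first by rewrite -phiE /phi /= chart_mapK.
move=> eps gd y kt mu beta gamma delta.
have [_ _ sym_g unit_g] := hg.
have symE i j : gd y i j = gd y j i.
  by have /matrixP/(_ j i) := sym_g _ Oz; rewrite mxE.
(* Since [r = 0] at this point, the fiber Ricci tensor is a multiple of the metric: the left-hand
   sum collapses to one term, and the two terms in [a ^+ 2] cancel. *)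
have ricE i j : ricci_comp gd y i j = kt / n.-1%:R * gd y i j.
  by rewrite /ricci_comp (ricci_ricci0 hg Oz) r0 metric0l add0r metric_delta2.
have mixE i e : ricci_mixed gd y i e = kt / n.-1%:R * (i == e)%:R.
  transitivity (kt / n.-1%:R * (invmx (gd y) *m gd y) e i).
    rewrite mxE mulr_sumr; apply: eq_bigr => k _.
    by rewrite ricE symE mulrCA.
  by rewrite mulVmx ?unit_g // mxE eq_sym.
have GE : G_comp gd y mu beta gamma delta
    = gd y beta gamma * gd y mu delta - gd y mu gamma * gd y beta delta.
  by rewrite /G_comp /tensor_G /wedge metricDl metricNl !metricZl !metric_delta2.
rewrite (bigD1 mu) //= big1 => [|e emu]; last first.
  by rewrite mixE eq_sym (negPf emu) mulr0 mul0r.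
by rewrite mixE eqxx mulr1 addr0 nE GE !ricE; ring.
Qed.
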